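(* Let $T>0$ and consider the system, for $i=1,\dots,N$, $$x_i'(t)=-d_i(t,x_i(t))+\sum_{l=1,\,l\ne i}^{N} b_{i,l}(t,x_l(t))+\sum_{j=1}^{k}p_{i,j}(t)\,f(x_i(t-\tau_j))-H_i(t,x(t)),$$ with coefficients $T$-periodic in $t$ and with the standing assumptions given in the context. Assume that there is $\delta>0$ such that $$G_i^0(t)<(1-\delta)\Big(\sum_{l=1,\,l\neq i}^{N}b_{0_{i,l}}(t)+\sum_{j=1}^{k}p_{i,j}(t)\Big)\qquad\text{for all } t,\ i=1,\dots,N,$$ and that there is $\beta>0$ such that $$G_{i,\infty}(t)>\sum_{l=1,\,l\ne i}^{N}b^{\infty}_{i,l}(t)+\beta\qquad\text{for all } t,\ i=1,\dots,N.$$ Then the system has at least one non-trivial (i.e. not identically zero) $T$-periodic solution with values in $[0,+\infty)^N$.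
   Context: $N,k\ge 1$ are integers, $\tau_1,\dots,\tau_k>0$ are delays, and $f(y):=ye^{-y}$. The functions $d_i,b_{i,l}:\mathbb{R}\times[0,+\infty)\to[0,+\infty)$, $H_i:\mathbb{R}\times[0,+\infty)^N\to[0,+\infty)$ and $p_{i,j}:\mathbb{R}\to[0,+\infty)$ are continuous, nonnegative (possibly nonlinear) and $T$-periodic in $t$. Set $G_i(t,x):=d_i(t,x_i)+H_i(t,x)$ for $x=(x_1,\dots,x_N)$; it is assumed that each quotient $G_i(t,x)/x_i$ is bounded from above (over all $t$ and $x\in[0,+\infty)^N$ with $x_i>0$). Define, for $l\neq i$, $$G_i^0(t):=\limsup_{x_i\to0^+}\frac{G_i(t,x)}{x_i},\qquad b_{0_{i,l}}(t):=\liminf_{x_l\to0^+}\frac{b_{i,l}(t,x_l)}{x_l},$$ $$G_{i,\infty}(t):=\liminf_{x_i\to+\infty}\frac{G_i(t,x)}{x_i},\qquad b^{\infty}_{i,l}(t):=\limsup_{x_l\to+\infty}\frac{b_{i,l}(t,x_l)}{x_l}.$$ All these limits are assumed uniform in $t$, and $G_i^0$, $G_{i,\infty}$ also uniform in $x_l$, $l\neq i$; that is, for every $\eta>0$ there are $s,S>0$ such that for all $t$ and all $x\in[0,+\infty)^N$: $G_i(t,x)/x_i\le G_i^0(t)+\eta$ if $0<x_i<s$; $b_{i,l}(t,x_l)/x_l\ge b_{0_{i,l}}(t)-\eta$ if $0<x_l<s$; $G_i(t,x)/x_i\ge G_{i,\infty}(t)-\eta$ if $x_i>S$; $b_{i,l}(t,x_l)/x_l\le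 b^{\infty}_{i,l}(t)+\eta$ if $x_l>S$. *)

(* Defs.v *)
From mathcomp Require Import all_boot all_order all_algebra.
From mathcomp Require Import all_classical all_reals all_analysis.

Set Implicit Arguments.
Unset Strict Implicit.
Unset Printing Implicit Defensive.

Import Order.TTheory GRing.Theory Num.Theory.
Import numFieldNormedType.Exports.

Local Open Scope classical_set_scope.
Local Open Scope ring_scope.

(* A function on R x [0,+oo) or R x [0,+oo)^N is represented by a total one;
   its values at negative space arguments are never constrained nor used. *)

Definition orthant (R : realType) (N : nat) : set 'rV[R]_N :=
  [set x | forall i, 0 <= x 0 i].

Definition ricker (R : realType) (y : R) : R := y * expR (- y).

Definition Gsum (R : realType) (N : nat) (d : 'I_N -> R -> R -> R)
    (H : 'I_N -> R -> 'rV[R]_N -> R) (i : 'I_N) (t : R) (x : 'rV[R]_N) : R :=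
  d i t (x 0 i) + H i t x.

(* Inverse image of the filter F under x |-> x_i on the orthant: "x_i tends to
   F while the other coordinates of x range freely over [0,+oo)". *)
Definition coord_filter (R : realType) (N : nat) (i : 'I_N)
    (F : set_system R) : set_system 'rV[R]_N :=
  [set A | F [set y | forall x, orthant x -> x 0 i = y -> A x]].

Definition G_zero (R : realType) (N : nat) (G : 'I_N -> R -> 'rV[R]_N -> R)
    (i : 'I_N) (t : R) : \bar R :=
  limf_esup (fun x : 'rV[R]_N => (G i t x / x 0 i)%:E) (coord_filter i 0^'+).

Definition G_infty (R : realType) (N : nat) (G : 'I_N -> R -> 'rV[R]_N -> R)
    (i : 'I_N) (t : R) : \bar R :=
  limf_einf (fun x : 'rV[R]_N => (G i t x / x 0 i)%:E)
    (coord_filter i (pinfty_nbhs R)).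

Definition b_zero (R : realType) (N : nat) (b : 'I_N -> 'I_N -> R -> R -> R)
    (i l : 'I_N) (t : R) : \bar R :=
  limf_einf (fun y : R => (b i l t y / y)%:E) 0^'+.

Definition b_infty (R : realType) (N : nat) (b : 'I_N -> 'I_N -> R -> R -> R)
    (i l : 'I_N) (t : R) : \bar R :=
  limf_esup (fun y : R => (b i l t y / y)%:E) (pinfty_nbhs R).

Definition uniform_limits (R : realType) (N : nat)
    (G : 'I_N -> R -> 'rV[R]_N -> R) (b : 'I_N -> 'I_N -> R -> R -> R) : Prop :=
  forall eta : R, 0 < eta -> exists s S : R, [/\ 0 < s, 0 < S &
    forall (t : R) (x : 'rV[R]_N) (i : 'I_N), orthant x ->
    [/\ 0 < x 0 i < s -> ((G i t x / x 0 i)%:E <= G_zero G i t + eta%:E)%E,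
        S < x 0 i -> (G_infty G i t - eta%:E <= (G i t x / x 0 i)%:E)%E &
        forall l : 'I_N, l != i ->
          (0 < x 0 l < s ->
             (b_zero b i l t - eta%:E <= (b i l t (x 0 l) / x 0 l)%:E)%E) /\
          (S < x 0 l ->
             ((b i l t (x 0 l) / x 0 l)%:E <= b_infty b i l t + eta%:E)%E)]].

Definition is_solution (R : realType) (N k : nat) (tau : 'I_k -> R)
    (d : 'I_N -> R -> R -> R) (b : 'I_N -> 'I_N -> R -> R -> R)
    (p : 'I_N -> 'I_k -> R -> R) (H : 'I_N -> R -> 'rV[R]_N -> R)
    (x : R -> 'rV[R]_N) : Prop :=
  forall (i : 'I_N) (t : R),
    is_derive t 1 (fun s : R => x s 0 i)
      (- d i t (x t 0 i) + \sum_(l < N | l != i) b i l t (x t 0 l)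
       + \sum_(j < k) p i j t * ricker (x (t - tau j) 0 i) - H i t (x t)).

(* Main.v *)
Require Import Defs.
From mathcomp Require Import all_boot zify.

(* The equation is discretised by Euler's scheme with n steps per period, the
   right-hand side being increased by a small theta > 0.  The map sending the
   grid values of one period to their successors preserves a box [0, B]^I, where B
   comes from the condition at infinity, so it has an approximate fixed point by
   Brouwer's theorem, obtained here from Scarf's combinatorial lemma.  This is an
   n-periodic Euler orbit, positive because theta > 0.

   Such an orbit cannot be uniformly small: otherwise consider a minimum, over the
   components and the grid, of the orbit divided by a weight w close to 1.  The
   condition at zero contradicts minimality when w decreases slightly; where
   \sum_l b_0 + \sum_j p is bounded below, w may even increase.  As this sum is only
   semicontinuous in t, the bound is available on some interval (Baire) but maybe not
   everywhere, and w is a sawtooth increasing on that interval only.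

   Orbits are bounded and Lipschitz uniformly in n.  Their pointwise limit along a
   fixed ultrafilter of grid sizes is the desired solution. *)

(** The unknowns of the fixed-point problem are all grid values of one period, with indices read
    modulo n. A delayed value is then just another coordinate: no history space is needed, and a
    fixed point is at once a whole periodic orbit.

    The fixed-point argument does not by itself exclude the zero function, so a lower bound
    independent of n has to come from the equation. Replacing the limits at zero by actual quotients
    costs an error eta, whereas the gain is delta / 2 times \sum_l b_0 + \sum_j p, which may be
    smaller than eta at some times however small eta is. The loss over most of the period is
    therefore paid for on an interval where the gain exceeds a multiple of a fixed kappa. Values at
    different times are compared only through w, which stays between 1 and 1 + delta / 4; this ratio
    and the loss in f(y) >= y (1 - y) are covered by the factor 1 - delta. Hence the order of
    choices: delta, then the interval and kappa, then eta, then the threshold r. *)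

Set Implicit Arguments.
Unset Strict Implicit.
Unset Printing Implicit Defensive.

(** * Scarf's lemma *)

Section Scarf.
Variables (Y J : finType) (k : J -> Y -> nat).
Hypothesis k_inj : forall j, injective (k j).

(** No point may lie strictly above the minimum of [B] in all orders at once. Dominant sets of size
    [#|J|] act as the simplices (rooms) of a triangulation, those with one point less as its facets
    (doors). *)
Definition dominant (B : {set Y}) :=
  [forall x, exists j, forall y in B, k j x <= k j y].

(** The candidates to complete [B] by a point that becomes the minimum for the order [a], each other
    order keeping its minimum in [B]. *)
Definition above (B : {set Y}) (a : J) :=
  [set y | [forall (j | j != a), exists b in B, k j b < k j y]].

Definition top (B : {set Y}) (a : J) :=
  [set y in above B a | [forall z in above B a, k a z <= k a y]].

Definition completions (B : {set Y}) := [set y | y \notin B & dominant (y |: B)].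

Lemma dominantP (B : {set Y}) :
  reflect (forall x, exists j, forall y, y \in B -> k j x <= k j y) (dominant B).
Proof.
apply: (iffP forallP) => h x.
  by have /existsP[j /forall_inP hj] := h x; exists j.
by have [j hj] := h x; apply/existsP; exists j; apply/forall_inP.
Qed.

Lemma aboveP (B : {set Y}) a y :
  reflect (forall j, j != a -> exists2 b, b \in B & k j b < k j y) (y \in above B a).
Proof.
rewrite inE; apply: (iffP forallP) => h j.
  by move=> ja; have /implyP/(_ ja)/exists_inP[b bB hb] := h j; exists b.
by apply/implyP => ja; have [b bB hb] := h j ja; apply/exists_inP; exists b.
Qed.

Lemma dominantS (A B : {set Y}) : A \subset B -> dominant B -> dominant A.
Proof.
move=> /subsetP AB /dominantP h; apply/dominantP => x.
by have [j hj] := h x; exists j => y /AB; apply: hj.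
Qed.

Lemma card_top B a : #|top B a| = (above B a != set0).
Proof.
have [M0|[y0 y0M]] := set_0Vmem (above B a).
  rewrite M0 eqxx; apply/eqP; rewrite cards_eq0; apply/eqP/setP => y.
  by rewrite [top B a]/top M0 !inE.
have -> : above B a != set0 by apply/set0Pn; exists y0.
case: (arg_maxnP (k a) y0M) => y yM ymax.
suff -> : top B a = [set y] by rewrite cards1.
apply/setP => z; rewrite [z \in top B a]inE [z \in [set y]]inE.
apply/andP/eqP => [[zM /forall_inP zmax]|->].
  by apply: (@k_inj a); apply/eqP; rewrite eqn_leq zmax ?andbT //; exact: ymax.
by split => //; apply/forall_inP => x xM; exact: ymax.
Qed.

(* Two orders [j1] and [j2] share their least element of [B]; a completion of [B] is
   the greatest, for one of them, of the points above [B] for all the other orders. *)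
Lemma completionsE B : B != set0 -> #|B|.+1 = #|J| -> dominant B ->
  exists j1 j2, j1 != j2 /\ completions B = top B j1 :|: top B j2.
Proof.
move=> /set0Pn[b0 b0B] cardB domB.
pose mn j := [arg min_(y < b0 in B) k j y].
have mnP j : mn j \in B /\ forall y, y \in B -> k j (mn j) <= k j y.
  by rewrite /mn; case: arg_minnP.
have mnB j : mn j \in B by case: (mnP j).
have mn_le j y : y \in B -> k j (mn j) <= k j y by case: (mnP j) => _; apply.
have mn_surj (A : {set Y}) (f : J -> Y) : dominant A ->
    (forall j, f j \in A /\ forall y, y \in A -> k j (f j) <= k j y) ->
    f @: setT = A.
  move=> domA fP; apply/setP => y; apply/imsetP/idP => [[j _ ->]|yA].
    by case: (fP j).
  move/dominantP: domA => /(_ y)[j hj]; exists j => //.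
  by apply: (@k_inj j); apply/eqP; rewrite eqn_leq hj ?(proj1 (fP j))//= (proj2 (fP j)).
have mnT : mn @: setT = B by apply: mn_surj.
have [j1 [j2 [j12 mn12]]] : exists j1 j2, j1 != j2 /\ mn j1 = mn j2.
  have : ~~ injectiveb mn.
    apply/negP => /injectiveP mn_inj.
    have := card_imset [set: J] mn_inj; rewrite mnT cardsT; lia.
  by move=> /injectivePn[j1 [j2 j12 e]]; exists j1, j2.
have mn_inj a : a \in [set j1; j2] -> {in ~: [set a] &, injective mn}.
  move=> ha; apply/imset_injP.
  have -> : mn @: (~: [set a]) = B.
    apply/eqP; rewrite eqEsubset; apply/andP; split.
      by rewrite -mnT imsetS // subsetT.
    rewrite -mnT; apply/subsetP => _ /imsetP[j _ ->].
    have [->|ja] := eqVneq j a; last by rewrite imset_f // !inE.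
    move: ha; rewrite !inE => /orP[] /eqP ->.
      by rewrite mn12 imset_f // !inE eq_sym.
    by rewrite -mn12 imset_f // !inE.
  by rewrite cardsC1; apply/eqP; lia.
have notin a y : a \in [set j1; j2] -> y \in above B a -> y \notin B.
  move=> ha /aboveP yM; apply/negP => yB.
  have [j] : exists2 j, j != a & y = mn j.
    move: yB; rewrite -mnT => /imsetP[j _ ->].
    have [->|ja] := eqVneq j a; last by exists j.
    move: ha; rewrite !inE => /orP[] /eqP ->.
      by exists j2; rewrite // eq_sym.
    by exists j1.
  move=> ja ye; have [b bB] := yM _ ja.
  by rewrite ye ltnNge mn_le.
have below a y : y \in above B a -> forall z, z \in B -> k a y <= k a z.
  move=> /aboveP yM z zB; move/dominantP: domB => /(_ y)[j hj].
  have [<-|ja] := eqVneq j a; first exact: hj.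
  by have [b bB] := yM _ ja; rewrite ltnNge hj.
exists j1, j2; split => //.
apply/setP => y; rewrite [y \in completions B]inE [RHS]inE; apply/andP/orP.
  move=> [yB domyB].
  pose mn' j := if k j y < k j (mn j) then y else mn j.
  have mn'P j : mn' j \in y |: B /\ forall z, z \in y |: B -> k j (mn' j) <= k j z.
    rewrite /mn' !inE; case: ltnP => h; split; rewrite ?eqxx ?mnB ?orbT //.
      move=> z /setU1P[->//|zB].
      by apply: leq_trans (ltnW h) _; apply: mn_le.
    by move=> z /setU1P[->//|zB]; apply: mn_le.
  have mn'T := mn_surj _ _ domyB mn'P.
  have mn'_inj : injective mn'.
    suff : {in setT &, injective mn'} by move=> h i j; apply: h; rewrite inE.
    by apply/imset_injP; rewrite mn'T cardsU1 yB cardsT; apply/eqP; lia.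
  have [a _ ya] : exists2 a, a \in setT & y = mn' a.
    by apply/imsetP; rewrite mn'T setU11.
  have mn'a j : j != a -> mn' j = mn j /\ k j (mn j) < k j y.
    move=> ja; have : mn' j != y by rewrite ya (inj_eq mn'_inj).
    rewrite /mn'; case: ltnP; rewrite ?eqxx // => h _; split => //.
    rewrite ltn_neqAle h andbT; apply/eqP => /(@k_inj j) e.
    by move: yB; rewrite -e mnB.
  have yM : y \in above B a.
    by apply/aboveP => j /mn'a[_ h]; exists (mn j).
  have yT : y \in top B a.
    rewrite [_ \in top B a]inE yM; apply/forall_inP => z zM.
    move/dominantP: domyB => /(_ z)[j hj].
    have [<-|ja] := eqVneq j a; first by apply: hj; rewrite setU11.
    move/aboveP: zM => /(_ _ ja)[b bB]; rewrite ltnNge hj //.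
    by rewrite setU1r.
  have : a \in [set j1; j2].
    rewrite !inE; case: (eqVneq a j1) => //= aj1; case: (eqVneq a j2) => //= aj2.
    have [|e1 _] := mn'a j1; first by rewrite eq_sym.
    have [|e2 _] := mn'a j2; first by rewrite eq_sym.
    by move: j12; rewrite -(inj_eq mn'_inj) e1 e2 mn12 eqxx.
  by move=> /set2P[] e; [left|right]; rewrite -e.
have main a : a \in [set j1; j2] -> y \in top B a -> y \notin B /\ dominant (y |: B).
  move=> ha; rewrite [_ \in top B a]inE => /andP[yM /forall_inP ymax].
  split; first exact: notin yM.
  apply/dominantP => z; have [zM|] := boolP (z \in above B a).
    exists a => x /setU1P[->|xB]; first exact: ymax.
    exact: below zM _ xB.
  rewrite [_ \in above _ _]inE => /forall_inPn[j ja]; rewrite negb_exists_in => /forall_inP h.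
  exists j => x /setU1P[->|xB]; last by rewrite leqNgt h.
  move/aboveP: yM => /(_ _ ja)[b bB hb].
  by apply: leq_trans (ltnW hb); rewrite leqNgt h.
by case; apply: main; rewrite !inE eqxx ?orbT.
Qed.

(** A common point would exceed the minimum of [B] in every order, against dominance. *)
Lemma disjoint_top B j1 j2 : B != set0 -> dominant B -> j1 != j2 ->
  [disjoint top B j1 & top B j2].
Proof.
move=> /set0Pn[b0 b0B] /dominantP domB j12; rewrite -setI_eq0.
apply/eqP/setP => y; rewrite [RHS]inE; apply/negP.
rewrite inE => /andP[]; rewrite [_ \in top B j1]inE [_ \in top B j2]inE.
move=> /andP[/aboveP h1 _] /andP[/aboveP h2 _].
have [j hj] := domB y.
have [b bB] : exists2 b, b \in B & k j b < k j y.
  have [e|] := eqVneq j j1; last exact: h1.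
  by apply: h2; rewrite e.
by rewrite ltnNge hj.
Qed.

Lemma card_completions B : B != set0 -> #|B|.+1 = #|J| -> dominant B ->
  exists j1 j2, j1 != j2 /\
    #|completions B| = (above B j1 != set0) + (above B j2 != set0).
Proof.
move=> B0 cB dB; have [j1 [j2 [j12 e]]] := completionsE B0 cB dB.
exists j1, j2; split => //; rewrite e cardsU.
have := disjoint_top B0 dB j12; rewrite -setI_eq0 => /eqP ->.
by rewrite cards0 subn0 !card_top.
Qed.

Variables (c : Y -> J) (j0 : J).

(** The doors of the parity count. By the cardinality, each colour other than [j0] is worn exactly
    once. *)
Definition good (B : {set Y}) :=
  [&& #|B|.+1 == #|J|, dominant B & c @: B == ~: [set j0]].

(** The number is 0 or 2. If [R :\ x] is good, then [x] does not have colour [j0], as [R] would show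
    all colours; so it shares its colour with exactly one other [x'], and only the removal of [x] or
    of [x'] leaves a good face. *)
Lemma card_good_faces (R : {set Y}) : #|R| = #|J| -> dominant R ->
  c @: R != setT -> ~~ odd #|[set x in R | good (R :\ x)]|.
Proof.
move=> cardR domR RT; set F := [set x in R | _].
have [->|[x]] := set_0Vmem F; first by rewrite cards0.
rewrite inE => /andP[xR /and3P[/eqP cRx domRx /eqP imRx]].
have imU y : y \in R -> c @: R = c y |: c @: (R :\ y).
  by move=> yR; rewrite -[in LHS](setD1K yR) imsetU1.
have [x' x'R cx'] : exists2 x', x' \in R :\ x & c x = c x'.
  apply/imsetP; rewrite imRx; apply: contraT; rewrite !inE negbK => /eqP cx.
  by move: RT; rewrite (imU x xR) imRx cx setUCr eqxx.
have inj y : y \in R -> c @: (R :\ y) = ~: [set j0] -> {in R :\ y &, injective c}.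
  move=> yR im; apply/imset_injP; rewrite im cardsC1.
  by have := cardsD1 y R; rewrite yR cardR => ->; apply/eqP; lia.
move: (x'R); rewrite !inE => /andP[x'x x'R'].
suff -> : F = [set x; x'] by rewrite cards2 eq_sym x'x.
have im2 : c @: (R :\ x') = c @: (R :\ x).
  apply/setP => j; apply/imsetP/imsetP => -[y yR ->].
    have [->|yx] := eqVneq y x; first by exists x'.
    by exists y => //; move: yR; rewrite !inE yx => /andP[].
  have [->|yx] := eqVneq y x'; first by exists x; rewrite // !inE eq_sym x'x.
  by exists y => //; move: yR; rewrite !inE yx => /andP[].
apply/setP => y; rewrite [in LHS]inE; apply/andP/set2P => [[yR /and3P[_ _ /eqP im]]|].
  have [->|yx] := eqVneq y x; first by left.
  have [->|yx'] := eqVneq y x'; first by right.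
  have e : x = x'.
    by apply: (inj y yR im) cx'; rewrite !inE ?xR ?x'R' ?andbT eq_sym.
  by move: x'x; rewrite e eqxx.
case=> [->|->]; first by rewrite xR /good cRx domRx imRx !eqxx.
rewrite x'R' /good im2 imRx eqxx andbT; split => //; apply/andP; split.
  by have := cardsD1 x' R; have := cardsD1 x R; rewrite xR x'R'; lia.
exact: dominantS (subsetDl _ _) domR.
Qed.

(** Pairs of a good door and a room containing it are counted twice. By doors the number is odd,
    since only [B0] has a single completion; by rooms it is even unless some room shows all
    colours. *)
Lemma colourful_room (B0 : {set Y}) :
    good B0 -> #|completions B0| = 1 ->
    (forall B, good B -> B != B0 -> #|completions B| = 2) ->
  exists2 B, dominant B & #|B| = #|J| /\ c @: B = setT.
Proof.
move=> goodB0 c1 c2.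
pose full R := [&& dominant R, #|R| == #|J| & c @: R == setT].
have [R /and3P[h1 /eqP h2 /eqP h3]|nofull] := pickP full; first by exists R.
have count : \sum_(B | good B) #|completions B| =
   \sum_(R : {set Y} | (#|R| == #|J|) && dominant R) #|[set x in R | good (R :\ x)]|.
  under eq_bigr do rewrite -sum1_card.
  under [RHS]eq_bigr do rewrite -sum1_card.
  rewrite !pair_big_dep /=.
  (* A door with a completing point is the same as a room with a removed point. *)
  rewrite (reindex_onto (fun p : {set Y} * Y => (p.1 :\ p.2, p.2)) (fun p => (p.2 |: p.1, p.2)))
    /=; last first.
    by move=> [B y] /=; rewrite !inE /= => /andP[_ /andP[yB _]]; rewrite setU1K.
  apply: eq_bigl => -[R x] /=; rewrite !inE /= eqxx /=.
  apply/idP/idP.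
    move=> /andP[/andP[g d] /eqP[e]]; rewrite e in d.
    have xR : x \in R by rewrite -e setU11.
    rewrite d g xR andbT /= andbT; move: g => /and3P[/eqP g _ _].
    by have := cardsD1 x R; rewrite xR => ->; rewrite -g add1n.
  move=> /andP[/andP[cR d] /andP[xR g]].
  by rewrite g /= (setD1K xR) d xpair_eqE !eqxx.
have : odd (\sum_(B | good B) #|completions B|).
  rewrite (bigD1 B0) //= c1 oddD /=.
  rewrite (big_morph odd oddD (erefl : odd 0 = false)) big1 // => B /andP[gB BB0].
  by rewrite c2.
rewrite count (big_morph odd oddD (erefl : odd 0 = false)) big1 // => R /andP[/eqP cR dR].
apply/negbTE; apply: card_good_faces => //.
by have := nofull R; rewrite /full dR cR eqxx /= => ->.
Qed.
End Scarf.

(* Each [i : J] is added as a slack point [inr i], below everything for the order [i]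
   and above [X] for the others; the result is then a parity count as in Sperner's lemma. *)
Lemma scarf (X J : finType) (k : J -> X -> nat) (c : X -> J) (x0 : X) :
    (forall j, injective (k j)) -> 1 < #|J| ->
  exists s : {set X}, s != set0 /\
    forall x, exists2 j, j \in c @: s & forall y, y \in s -> k j x <= k j y.
Proof.
move=> k_inj J1.
pose b j := (\max_x k j x).+2.
have kb j x : (k j x).+1 < b j by rewrite /b !ltnS; apply: leq_bigmax.
pose K j (y : X + J) := match y with
  | inl x => (k j x).+1
  | inr i => if i == j then 0 else b j + enum_rank i end.
have K_inj j : injective (K j).
  move=> [x|i] [y|l] /=.
  - by move=> [] /k_inj ->.
  - by case: eqP => // _ e; have := kb j x; rewrite e ltnNge leq_addr.
  - by case: eqP => // _ e; have := kb j y; rewrite -e ltnNge leq_addr.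
  case: eqP => [->|_]; case: eqP => [->|_] //.
  by move/addnI/ord_inj/enum_rank_inj => ->.
pose cc (y : X + J) := match y with inl x => c x | inr i => i end.
have [j0 _] : exists j0 : J, j0 \in J by apply/card_gt0P; apply: ltnW.
(* The boundary door: its only completion will be the point of [X] that is greatest for the order
   [j0]. *)
pose B0 : {set X + J} := inr @: (~: [set j0]).
have inB0 j : (inr j \in B0) = (j != j0).
  by rewrite mem_imset ?inE //; apply: inr_inj.
have inB0l x : (inl x \in B0) = false by apply/negP => /imsetP[].
have c0 : cc @: B0 = ~: [set j0].
  by rewrite -imset_comp /=; rewrite (eq_imset (g := id)) ?imset_id.
have cardB0 : #|B0|.+1 = #|J|.
  by rewrite card_imset ?cardsC1 ?prednK //; [apply: ltnW | apply: inr_inj].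
pose xm := [arg max_(x > x0) k j0 x].
have xmP x : k j0 x <= k j0 xm by rewrite /xm; case: arg_maxnP => // y _; apply.
have domm : dominant K (inl xm |: B0).
  apply/dominantP => -[x|j]; last by exists j => y _; rewrite /= eqxx.
  exists j0 => -[y|j]; rewrite !inE ?inB0l ?orbF => /eqP e.
    by case: e => ->; rewrite /= ltnS.
  move: e; rewrite inB0 => /eqP /= /negPf ->.
  by apply: leq_trans (leq_addr _ _); apply/ltnW/kb.
have g0 : good K cc j0 B0.
  rewrite /good cardB0 c0 !eqxx andbT /=.
  by apply: dominantS domm; apply: subsetUr.
have [|||B dB [cB iB]] := @colourful_room _ _ K cc j0 B0.
- exact: g0.
- suff -> : completions K B0 = [set inl xm] by rewrite cards1.
  apply/setP => -[x|j]; rewrite !inE ?inB0l ?inB0 /=.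
    apply/dominantP/eqP => [h|[->]]; last exact/dominantP.
    have hx x' : k j0 x' <= k j0 x.
      have [j hj] := h (inl x'); have [e|jj0] := eqVneq j j0.
        by have := hj (inl x); rewrite setU11 e /= ltnS => /(_ isT).
      by have := hj (inr j); rewrite !inE inB0 jj0 /= eqxx => /(_ isT).
    by congr inl; apply: (k_inj j0); apply/eqP; rewrite eqn_leq hx xmP.
  rewrite negbK; apply/negP => /andP[/eqP -> /dominantP /(_ (inl x0))[i hi]].
  by have := hi (inr i); rewrite in_setU1 inB0 (inj_eq inr_inj) orbN /= eqxx => /(_ isT).
- move=> B /and3P[/eqP cB dB /eqP iB] BB0.
  have B1 : B != set0 by rewrite -card_gt0; lia.
  (* Without a point of [X], the door would consist of slack points of colours other than [j0],
     hence be [B0]. A point of [X] makes [inr a] an element of [above K B a] for every [a], so that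
     both completions exist. *)
  have [x xB] : exists x, inl x \in B.
    have [/existsP[x]|] := boolP [exists x, inl x \in B]; first by exists x.
    rewrite negb_exists => /forallP h; case/negP: BB0.
    rewrite eqEcard; apply/andP; split; last by rewrite -ltnS cB cardB0.
    apply/subsetP => -[x|j] yB; first by have := h x; rewrite yB.
    rewrite inB0; have : cc (inr j) \in cc @: B by apply: imset_f.
    by rewrite iB !inE.
  have [j1 [j2 [_ ->]]] := card_completions K_inj B1 cB dB.
  suff h a : above K B a != set0 by rewrite !h.
  apply/set0Pn; exists (inr a); apply/aboveP => j ja; exists (inl x) => //=.
  by rewrite eq_sym (negPf ja); apply: leq_trans (kb j x) (leq_addr _ _).
pose s := [set x | inl x \in B].
have main x : exists2 j, j \in c @: s & forall y, y \in s -> k j x <= k j y.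
  have /dominantP/(_ (inl x))[j hj] := dB.
  (* The slack point [inr j] is the least one for the order [j], so it cannot be above [inl x]; the
     colour [j] is thus worn by a point of [X]. *)
  have jB : inr j \notin B by apply/negP => /hj /=; rewrite eqxx.
  exists j; last by move=> y; rewrite inE => /hj.
  have : j \in cc @: B by rewrite iB inE.
  case/imsetP => -[y|i] yB /= e; first by rewrite e imset_f ?inE.
  by move: jB; rewrite e yB.
exists s; split => //.
have [j /imsetP[x xs _] _] := main x0.
by apply/set0Pn; exists x.
Qed.

(** * Scarf's lemma on the integer points of a simplex *)

Definition grid (J : finType) (m : nat) : finType :=
  {z : {ffun J -> 'I_m.+1} | \sum_j z j == m}.

Definition grid_coord (J : finType) (m : nat) (z : grid J m) (j : J) : nat := val z j.

Lemma sum_grid_coord (J : finType) m (z : grid J m) : \sum_j grid_coord z j = m.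
Proof. exact/eqP/(valP z). Qed.

Lemma grid_of (J : finType) m (w : J -> nat) : \sum_j w j = m ->
  exists z : grid J m, forall j, grid_coord z j = w j.
Proof.
move=> sw; have wm j : w j < m.+1 by rewrite ltnS -sw (bigD1 j) //= leq_addr.
pose z : {ffun J -> 'I_m.+1} := [ffun j => Ordinal (wm j)].
have zP : \sum_j z j == m.
  by rewrite -[X in _ == X]sw; apply/eqP/eq_bigr => j _; rewrite ffunE.
by exists (exist _ z zP : grid J m) => j; rewrite /grid_coord /= ffunE.
Qed.

(** Let C be the colours of [s]. The minima of [s] over the coordinates in C nearly add up to the
    total [m]; hence points of [s] have little left outside C, and exceed the minima by little
    inside C. *)
Lemma scarf_grid (J : finType) m (c : grid J m -> J) : 1 < #|J| ->
  exists s : {set grid J m}, [/\ s != set0,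
    forall y, y \in s -> forall j,
      (exists2 y', y' \in s & c y' = j) \/ grid_coord y j <= #|J| &
    forall y y', y \in s -> y' \in s -> forall j,
      grid_coord y j <= grid_coord y' j + #|J|].
Proof.
move=> J1; have [j0 _] : exists j0 : J, j0 \in J by apply/card_gt0P; apply: ltnW.
pose X := grid J m.
have [x0 _] : exists z : X, forall j, grid_coord z j = (j == j0) * m.
  apply: grid_of; rewrite (bigD1 j0) //= eqxx mul1n big1 ?addn0 //.
  by move=> j /negPf ->.
(* Ties between equal coordinates are broken by the rank. *)
pose k (j : J) (z : X) := grid_coord z j * #|X| + enum_rank z.
have k_inj j : injective (k j).
  move=> y z e; apply: enum_rank_inj; apply: ord_inj.
  have := congr1 (modn^~ #|X|) e; rewrite /k !modnMDl !modn_small //; exact: ltn_ord.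
have k_le j y z : k j y <= k j z -> grid_coord y j <= grid_coord z j.
  have h1 : enum_rank z < #|X| := ltn_ord _.
  move=> h2; rewrite leqNgt; apply/negP => h3.
  move: (leq_mul h3 (leqnn #|X|)) h1 h2; rewrite mulSn /k.
  by move: (enum_rank y : nat) (enum_rank z : nat) => ? ?; lia.
have [s [s0 sP]] := scarf c x0 k_inj J1.
exists s; move/set0Pn: (s0) => [y0 y0s].
set C := c @: s in sP.
pose mn j := grid_coord [arg min_(y < y0 in s) grid_coord y j] j.
have mn_le j y : y \in s -> mn j <= grid_coord y j.
  by rewrite /mn; case: arg_minnP => // z _; apply.
have mn_ex j : exists2 y, y \in s & mn j = grid_coord y j.
  by rewrite /mn; case: arg_minnP => // z zs _; exists z.
(* Otherwise the total [m] would allow a grid point strictly above all minima in the coordinates of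
   C, the surplus being put on the coordinate [c y0]. This contradicts the choice of [s]. *)
have sum_mn : m < \sum_(j in C) mn j + #|C|.
  rewrite ltnNge; apply/negP => le_m.
  have cC : c y0 \in C by apply: imset_f.
  pose w j := (if j \in C then (mn j).+1 else 0) +
    (if j == c y0 then m - (\sum_(j in C) mn j + #|C|) else 0).
  have [|z zw] := @grid_of J m w.
    rewrite /w big_split /= -big_mkcond /= -(big_mkcond (pred1 (c y0))) big_pred1_eq.
    under eq_bigr do rewrite -addn1.
    by rewrite big_split /= sum1_card subnKC.
  have [j jC hj] := sP z; have [y ys e] := mn_ex j.
  by have := k_le _ _ _ (hj y ys); rewrite zw -e /w jC; lia.
have CJ : #|C| <= #|J| by apply: max_card.
have arith a b e d n k1 : n < a + k1 -> a <= b -> b + (e + d) = n -> e <= k1 by lia.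
have sum_le y : y \in s -> \sum_(j in C) mn j <= \sum_(j in C) grid_coord y j.
  by move=> ys; apply: leq_sum => i _; apply: mn_le.
have outC y j : y \in s -> j \notin C -> grid_coord y j <= #|J|.
  move=> ys jC; apply: leq_trans CJ; apply: (arith _ _ _ _ _ _ sum_mn (sum_le y ys)).
  rewrite -[in RHS](sum_grid_coord y) [in RHS](bigID (mem C)) /=.
  by rewrite [in RHS](bigD1 j (P := fun i => i \notin C)).
split => // [y ys j|y y' ys y's j].
  have [/imsetP[y' y's ->]|jC] := boolP (j \in C); [by left; exists y'|right].
  exact: outC.
have [jC|jC] := boolP (j \in C); last first.
  by apply: leq_trans (leq_addl _ _); apply: outC.
have arith2 a b g d e f n k1 : n < a + b + k1 -> b <= e -> (f + e) + d = n -> a <= g -> f <= g + k1.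
  by lia.
apply: leq_trans (_ : grid_coord y' j + #|C| <= _); last by rewrite leq_add2l.
move: sum_mn; rewrite (bigD1 j) //= => sum_mn.
apply: (arith2 _ _ _ (\sum_(i | i \notin C) grid_coord y i)
  (\sum_(i in C | i != j) grid_coord y i) _ _ _ sum_mn).
- by apply: leq_sum => i _; apply: mn_le.
- by rewrite -(bigD1 j (P := mem C)) //= -[in RHS](sum_grid_coord y) [in RHS](bigID (mem C)).
- exact: mn_le.
Qed.

(* Late import: finset and classical_sets both define [set0], [setT]. *)
From mathcomp Require Import all_boot all_order all_algebra.
From mathcomp Require Import all_classical all_reals all_analysis.
From mathcomp Require Import zify ring lra.
Import Order.TTheory GRing.Theory Num.Theory.
Import numFieldNormedType.Exports.
Local Open Scope classical_set_scope.
Local Open Scope ring_scope.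

(** * Approximate fixed points in a box *)

(** The box sits in a simplex of total [#|I| * B], with one slack coordinate [None]. A grid point
    gets a colour [j] whose coordinate is not decreased by the map. On the small set given by
    Scarf's lemma every coordinate is almost not decreased; as the coordinates keep their sum, every
    one is almost fixed. *)
Lemma brouwer_box (R : realType) (I : finType) (B : R) (K : (I -> R) -> I -> R) :
    (0 < #|I|)%N -> 0 < B ->
    (forall u, (forall i, 0 <= u i <= B) -> forall i, 0 <= K u i <= B) ->
    (forall e, 0 < e -> exists2 delta, 0 < delta & forall u v,
      (forall i, 0 <= u i <= B) -> (forall i, 0 <= v i <= B) ->
      (forall i, `|u i - v i| <= delta) -> forall i, `|K u i - K v i| <= e) ->
  forall e, 0 < e -> exists u, (forall i, 0 <= u i <= B) /\
    forall i, `|K u i - u i| <= e.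
Proof.
move=> I0 B0 Kbox Kunif e e0.
pose J : finType := option I.
have cardJ : #|J| = #|I|.+1 by rewrite card_option.
pose c : R := #|J|%:R; pose L : R := #|I|%:R * B.
have c1 : 1 <= c by rewrite /c cardJ ler1n.
have L0 : 0 < L by rewrite mulr_gt0 // ltr0n.
(* The final error is [c * e1] with [e1 <= 2 * (c * e')]. *)
pose e' := e / (2 * c ^+ 2).
have e'0 : 0 < e' by rewrite divr_gt0 // mulr_gt0 // exprn_gt0 //; lra.
have [delta delta0 Kdelta] := Kunif _ e'0.
have [m m1 m2] : exists2 m : nat, L * c / m.+1%:R <= delta & L * c / m.+1%:R <= c * e'.
  pose a := Num.min delta (c * e').
  have a0 : 0 < a by rewrite lt_min delta0 mulr_gt0 //; lra.
  have [m ma] : exists m : nat, L * c / m.+1%:R <= a.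
    exists (Num.truncn (L * c / a)).
    have := truncnS_gt (L * c / a); rewrite ltr_pdivrMr // [_ * a]mulrC => /ltW h1.
    by rewrite ler_pdivrMr.
  by exists m; apply: le_trans ma _; rewrite ge_min lexx ?orbT.
pose h : R := L / m.+1%:R.
have h0 : 0 < h by rewrite divr_gt0.
pose u (z : grid J m.+1) (j : J) : R := h * (grid_coord z j)%:R.
have u0 z j : 0 <= u z j by rewrite mulr_ge0 // ltW.
have sumu z : \sum_j u z j = L.
  rewrite -mulr_sumr -natr_sum sum_grid_coord /h.
  by rewrite -mulrA mulVf ?mulr1 // pnatr_eq0.
(* The simplex is larger than the box, so coordinates are truncated at [B] before [K] is applied.
   This is harmless at the end, [K] having values at most [B]. *)
pose x (z : grid J m.+1) (i : I) := Num.min B (u z (Some i)).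
have xbox z i : 0 <= x z i <= B by rewrite le_min ge_min lexx ltW //= u0.
pose f z (j : J) := if j is Some i then K (x z) i else L - \sum_i K (x z) i.
have sumJ (g : J -> R) : \sum_j g j = g None + \sum_i g (Some i).
  rewrite (bigD1 None) //=; congr (_ + _).
  rewrite (reindex_omap Some id) /=; last by case.
  by apply: eq_bigl => i; rewrite eqxx.
have sumf z : \sum_j f z j = L by rewrite sumJ /= subrK.
have f0 z j : 0 <= f z j.
  case: j => [i|] /=; first by have /andP[] := Kbox _ (xbox z) i.
  rewrite subr_ge0; apply: (@le_trans _ _ (\sum_(i : I) B)).
    by apply: ler_sum => i _; have /andP[] := Kbox _ (xbox z) i.
  by rewrite sumr_const /L mulr_natl.
(* Both families have the sum [L], so not every coordinate can decrease. *)
have colour_ex z : exists j, u z j <= f z j.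
  have [/existsP[j h1]|] := boolP [exists j, u z j <= f z j]; first by exists j.
  rewrite negb_exists => /forallP h1; exfalso.
  have : \sum_j f z j < \sum_j u z j.
    apply: ltr_sum => [|j _]; first by apply/hasP; exists None; rewrite ?mem_index_enum.
    by rewrite ltNge h1.
  by rewrite sumf sumu ltxx.
have [c0 c0P] := choice colour_ex.
have [|s [/set0Pn[y0 y0s] s1 s2]] := @scarf_grid J m.+1 c0.
  by rewrite cardJ ltnS.
have udist y j : y \in s -> `|u y j - u y0 j| <= h * c.
  move=> ys; rewrite ler_distlC /u /c.
  have := s2 _ _ ys y0s j; have := s2 _ _ y0s ys j.
  rewrite -!(ler_nat R) !natrD => a1 a2; apply/andP; split;
    rewrite -?mulrBr -?mulrDr ler_pM2l //; lra.
have hc : h * c = L * c / m.+1%:R by rewrite /h mulrAC.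
have fdist y j : y \in s -> `|f y j - f y0 j| <= c * e'.
  move=> ys.
  have Ke : forall i, `|K (x y) i - K (x y0) i| <= e'.
    apply: Kdelta => // i; apply: le_trans m1; rewrite -hc.
    apply: le_trans (udist y (Some i) ys); rewrite /x.
    move: (u y (Some i)) (u y0 (Some i)) => a b.
    by case: (leP B a); case: (leP B b) => ? ?; rewrite ?subrr ?normr0 //;
       rewrite ler_norml; have := ler_norm (a - b); have := ler_norm (b - a);
         rewrite (distrC b a); lra.
  case: j => [i|] /=.
    by apply: le_trans (Ke i) _; rewrite ler_peMl // ltW.
  have -> : L - \sum_i K (x y) i - (L - \sum_i K (x y0) i) = \sum_i (K (x y0) i - K (x y) i).
    by rewrite sumrB; ring.
  apply: le_trans (ler_norm_sum _ _ _) _.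
  apply: (@le_trans _ _ (\sum_(i : I) e')).
    by apply: ler_sum => i _; rewrite distrC.
  rewrite sumr_const /c cardJ -[_ *+ _]mulr_natl ler_pM2r // ler_nat; exact: leqnSn.
pose e1 := h * c + c * e'.
have lowf j : u y0 j - e1 <= f y0 j.
  have [[y ys yj]|small] := s1 _ y0s j.
    have := fdist y j ys; have := udist y j ys; have := c0P y; rewrite yj /e1.
    by rewrite !ler_norml; lra.
  have : u y0 j <= h * c by rewrite /u /c ler_pM2l // ler_nat.
  by have := f0 y0 j; have := mulr_gt0 (lt_le_trans ltr01 c1) e'0; rewrite /e1; lra.
have e10 : 0 <= e1 by rewrite /e1 addr_ge0 // mulr_ge0 ?ltW //; lra.
have ce1 : c * e1 <= e.
  have : e1 <= 2 * (c * e') by rewrite /e1 hc mulr_natl mulr2n lerD2r.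
  move=> /(ler_wpM2l (le_trans ler01 c1)) h1; apply: le_trans h1 _.
  suff -> : c * (2 * (c * e')) = e by [].
  by rewrite /e'; field; apply/eqP; lra.
exists (x y0); split => // i.
(* The differences add up to 0 and each [u y0 j - f y0 j] is at most [e1], so none is below the
   opposite of [#|J| * e1]. *)
have close : `|f y0 (Some i) - u y0 (Some i)| <= e.
  apply: le_trans ce1; rewrite ler_norml; apply/andP; split.
    have := lowf (Some i); have : e1 <= c * e1 by rewrite ler_peMl.
    by lra.
  have e2 : \sum_j (u y0 j - f y0 j) = 0 by rewrite sumrB sumu sumf subrr.
  have : \sum_(j | j != Some i) (u y0 j - f y0 j) <= \sum_(j : J | j != Some i) e1.
    by apply: ler_sum => j _; have := lowf j; lra.
  rewrite sumr_const cardC1.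
  have : e1 *+ #|J|.-1 <= c * e1 by rewrite -mulr_natl ler_wpM2r // ler_nat leq_pred.
  by move: e2; rewrite (bigD1 (Some i)) //=; lra.
apply: le_trans close; rewrite /= /x.
have /andP[k1 k2] := Kbox _ (xbox y0) i.
by case: (leP B (u y0 (Some i))) => // h1; rewrite ler0_norm ?ler0_norm; lra.
Qed.

(** * Periodic Euler orbits *)

Lemma compact_unif_continuous (R : realType) (V : normedModType R) (A : set V) (f : V -> R) :
    compact A -> continuous f -> forall e, 0 < e ->
  \forall delta \near 0^'+, forall x y, A x -> `|x - y| < delta -> `|f x - f y| < e.
Proof.
move=> /compact_near_coveringP cA cf e e0.
suff : \forall delta \near 0^'+, A `<=` [set x | forall y, `|x - y| < delta -> `|f x - f y| < e].
  by apply: filterS => delta h x y Ax; apply: h.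
apply: (cA R (0^'+) (fun delta x => forall y, `|x - y| < delta -> `|f x - f y| < e)) => x Ax.
have /cvgrPdist_lt/(_ _ (divr_gt0 e0 (ltr0n _ 2)))/nbhs_normP[r /= r0 hr] := cf x.
exists (ball x (r / 2), [set d | d < r / 2]); first split => /=.
- by apply: nbhsx_ballx; rewrite divr_gt0.
- by apply: nbhs_right_lt; rewrite divr_gt0.
move=> [x' delta] /= [xx' hd] y x'y.
have h1 : `|f x - f x'| < e / 2.
  by apply: hr; rewrite /= -ball_normE /= in xx' *; lra.
have h2 : `|f x - f y| < e / 2.
  apply: hr; rewrite /= -ball_normE /= in xx' *.
  by have := ler_distD x' x y; lra.
by have := ler_distD (f x) (f x') (f y); rewrite (distrC (f x') (f x)); lra.
Qed.

Lemma row_norm_lt (R : realType) N (x : 'rV[R]_N) (e : R) :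
  0 < e -> (forall l, `|x 0 l| < e) -> `|x| < e.
Proof.
move=> e0 h; rewrite [`|x|]mx_normrE; apply/bigmax_ltP; split => // -[i l] _ /=.
by rewrite ord1.
Qed.

Lemma coord_le_norm (R : realType) N (x : 'rV[R]_N) l : `|x 0 l| <= `|x|.
Proof. by rewrite [`|x|]mx_normrE; apply: (le_bigmax _ _ (0, l)). Qed.

Lemma int_residue (n : nat) (z : int) : (0 < n)%N ->
  exists q : 'I_n, exists e : int, z = (q : nat)%:Z + n%:Z * e.
Proof.
move=> n0; have z0 : (0 <= z %% n%:Z)%Z by rewrite modz_ge0; lia.
have zn : (z %% n%:Z < n%:Z)%Z by apply: ltz_pmod; lia.
have qn : (`|(z %% n%:Z)%Z|%N < n)%N by lia.
exists (Ordinal qn), (z %/ n%:Z)%Z.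
by rewrite /= gez0_abs // [LHS](divz_eq z n%:Z) addrC mulrC.
Qed.

Lemma inord_modz n (z : int) :
  ((inord `|(z %% n.+1%:Z)%Z|%N : 'I_n.+1) : int) = (z %% n.+1%:Z)%Z.
Proof.
have z0 : (0 <= z %% n.+1%:Z)%Z by rewrite modz_ge0.
have zn : (z %% n.+1%:Z < n.+1%:Z)%Z by apply: ltz_pmod.
by rewrite inordK; lia.
Qed.

Lemma ord_pred_le n (q : 'I_n.+1) : `|(q : nat)%:Z - 1| <= n.+1%:Z.
Proof. by have := ltn_ord q; lia. Qed.

Lemma periodic_int (V : zmodType) (U : Type) (T : V) (f : V -> U) :
  (forall t, f (t + T) = f t) -> forall (m : int) t, f (t + T *~ m) = f t.
Proof.
move=> per; have pern (n : nat) t : f (t + T *+ n) = f t.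
  elim: n t => [|n IH] t; first by rewrite mulr0n addr0.
  by rewrite mulrSr addrA per IH.
case=> n t; first by rewrite -pmulrn pern.
by rewrite NegzE mulrNz -pmulrn -[LHS](pern n.+1) subrK.
Qed.

Lemma periodic_bounded (R : realType) (V : normedModType R) (T : R) (A : set V)
    (f : R * V -> R) : 0 < T -> compact A -> continuous f ->
  (forall t x, f (t + T, x) = f (t, x)) ->
  exists C, forall t x, A x -> `|f (t, x)| <= C.
Proof.
move=> T0 cA cf per.
have /compact_bounded[C [_ hC]] : compact (f @` (`[0, T] `*` A)).
  apply: continuous_compact; first exact: continuous_subspaceT.
  by apply: compact_setX => //; apply: segment_compact.
exists (C + 1) => t x Ax.
rewrite -(periodic_int (f := fun t => f (t, x)) (T := T) _ (- Num.floor (t / T))) //.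
rewrite -mulrzl.
apply: (hC (C + 1)); first lra.
exists (t + (- Num.floor (t / T))%:~R * T, x) => //; split => //=.
have /andP[] := floor_itv (t / T); rewrite rmorphD /= ler_pdivlMr // ltr_pdivrMr // => h1 h2.
by rewrite in_itv /= rmorphN /=; apply/andP; split; lra.
Qed.

Lemma compact_box (R : realType) N (B : R) :
  compact [set x : 'rV[R]_N | forall l, 0 <= x 0 l <= B].
Proof.
have := @rV_compact R N (fun=> `[0, B]%classic) (fun=> @segment_compact R 0 B).
by congr compact; apply/seteqP; split => x /= h l; have := h l; rewrite in_itv.
Qed.

Section EulerOrbit.
Variables (R : realType) (N k : nat) (T : R) (tau : 'I_k -> R).
Variables (Phi : 'I_N -> R -> 'rV[R]_N -> 'rV[R]_k -> R).
Hypothesis T_gt0 : 0 < T.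
Hypothesis Phi_continuous : forall i,
  continuous (fun z : R * ('rV[R]_N * 'rV[R]_k) => Phi i z.1 z.2.1 z.2.2).
Hypothesis Phi_periodic : forall i t x y, Phi i (t + T) x y = Phi i t x y.

Definition in_box m (B : R) (x : 'rV[R]_m) := forall l, 0 <= x 0 l <= B.

Lemma Phi_unif_box (B : R) (a : R) (i : 'I_N) (e : R) : 0 < e ->
  exists2 delta, 0 < delta & forall (t : R) (x : 'rV[R]_N) (y : 'rV[R]_k) (x' : 'rV[R]_N) (y' :
    'rV[R]_k), `|t - a| <= T ->
    in_box B x -> in_box B y ->
    (forall l, `|x 0 l - x' 0 l| <= delta) -> (forall j, `|y 0 j - y' 0 j| <= delta) ->
    `|Phi i t x y - Phi i t x' y'| < e.
Proof.
move=> e0.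
have cA : compact (`[a - T, a + T] `*`
    ([set x : 'rV[R]_N | in_box B x] `*` [set y : 'rV[R]_k | in_box B y])).
  by do 2?[apply: compact_setX]; [exact: segment_compact|exact: compact_box|exact: compact_box].
have h := compact_unif_continuous cA (@Phi_continuous i) e0.
have /filter_ex[delta [delta0 hd]] : \forall delta \near 0^'+, 0 < delta /\
    (forall x y, (`[a - T, a + T] `*`
    ([set x : 'rV[R]_N | in_box B x] `*` [set y : 'rV[R]_k | in_box B y])) x ->
    `|x - y| < delta -> `|Phi i x.1 x.2.1 x.2.2 - Phi i y.1 y.2.1 y.2.2| < e).
  by apply: filterI => //; apply: nbhs_right_gt.
exists (delta / 2); first lra.
move=> t x y x' y' ta bx by_ xx' yy'.
apply: (hd (t, (x, y)) (t, (x', y'))).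
  split => //=; rewrite in_itv /=; move: ta; rewrite ler_norml; lra.
rewrite !prod_normE /= !gt_max subrr normr0 delta0 /=.
apply/andP; split; apply: row_norm_lt => // l; rewrite !mxE.
  by apply: le_lt_trans (xx' l) _; lra.
by apply: le_lt_trans (yy' l) _; lra.
Qed.

(** Integer indices with periodicity make every delayed index meaningful. The perturbation [theta]
    may vary with the step, which lets it absorb the error of an approximate fixed point. *)
Definition euler_orbit (a h eps B : R) n (v : 'I_N -> int -> R) :=
  [/\ forall i z, v i (z + n%:Z) = v i z,
      forall i z, 0 <= v i z <= B &
      forall i z, exists theta : R, 0 < theta <= eps /\
        v i (z + 1) = v i z + h * (Phi i (a + z%:~R * h) (\row_l v l z)
                        (\row_j v i (z - Num.floor (tau j / h))) + theta)].

(** The box is preserved: [Phi >= - (M * x_i)] and [h * M <= 1] keep values nonnegative; from below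
    [B - 1] a step rises by at most [h * (C + 1) <= 1], and from [B - 1] on it does not rise. *)
Lemma euler_orbit_exists (a M C B eps : R) n : (0 < N)%N ->
    let h := T / n.+1%:R in
    0 < eps <= 1 -> 0 < B -> h * M <= 1 -> h * (C + 1) <= 1 ->
    (forall i t x y, in_box B x -> in_box B y -> - (M * x 0 i) <= Phi i t x y <= C) ->
    (forall i t x y, in_box B x -> in_box B y -> B - 1 <= x 0 i -> Phi i t x y <= - 1) ->
  exists v, euler_orbit a h eps B n.+1 v.
Proof.
move=> N0 h /andP[eps0 eps1] B0 hM hC PhiMC PhiB.
have n0 : (n.+1%:R : R) != 0 by [].
have h0 : 0 < h by rewrite divr_gt0.
have nh : n.+1%:R * h = T by rewrite /h mulrC divfK.
pose idx (z : int) : 'I_n.+1 := inord `|(z %% n.+1%:Z)%Z|%N.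
have idx_val z : (idx z : int) = (z %% n.+1%:Z)%Z by apply: inord_modz.
pose I : finType := ('I_N * 'I_n.+1)%type.
pose V (u : I -> R) i (z : int) := u (i, idx z).
have V_per u i m z : V u i (z + m * n.+1%:Z) = V u i z.
  by rewrite /V; congr (u (_, _)); apply/val_inj; rewrite /= /idx addrC modzMDl.
pose G u i z := Phi i (a + z%:~R * h) (\row_l V u l z)
                        (\row_j V u i (z - Num.floor (tau j / h))).
pose step u i (z : int) := V u i z + h * (G u i z + eps / 2).
have step_per u i m z : step u i (z + m * n.+1%:Z) = step u i z.
  rewrite /step V_per; congr (_ + _ * (_ + _)); rewrite /G.
  have -> : a + (z + m * n.+1%:Z)%:~R * h = a + z%:~R * h + m%:~R * T.
    by rewrite intrD intrM -nh -[n.+1%:~R]pmulrn; ring.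
  rewrite [_ * T]mulrzl (periodic_int (f := fun t => Phi i t _ _)) //; congr Phi.
    by apply/rowP => l; rewrite !mxE V_per.
  by apply/rowP => j; rewrite !mxE addrAC V_per.
(* The new value at an index comes from the Euler step at the preceding one, so a fixed point
   satisfies the recursion at all indices. *)
pose K (u : I -> R) (p : I) := step u p.1 ((p.2 : nat)%:Z - 1).
pose box (u : I -> R) := forall p, 0 <= u p <= B.
have rowbox u z : box u -> in_box B (\row_l V u l z) by move=> bu l; rewrite mxE; apply: bu.
have rowbox2 u i g : box u -> in_box B (\row_(j < k) V u i (g j)).
  by move=> bu l; rewrite mxE; apply: bu.
have Kbox u : box u -> forall p, 0 <= K u p <= B.
  move=> bu [i q]; rewrite /K /step /=; set z := _ - 1.
  have bx := rowbox u z bu; have by_ := rowbox2 u i (fun j => z - Num.floor (tau j / h)) bu.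
  have := PhiMC i (a + z%:~R * h) _ _ bx by_.
  have := PhiB i (a + z%:~R * h) _ _ bx by_.
  rewrite -/(G u i z) mxE.
  have /andP[w0 wB] : 0 <= V u i z <= B := bu _.
  move: (V u i z) w0 wB (G u i z) => w w0 wB g hB /andP[gM gC]; apply/andP; split.
    have : h * (- (M * w)) <= h * g by rewrite ler_pM2l.
    have : 0 <= w * (1 - h * M) by rewrite mulr_ge0 // subr_ge0.
    have : 0 < h * eps by rewrite mulr_gt0.
    by lra.
  have [/hB h1|h1] := leP (B - 1) w.
    have : h * (g + eps / 2) <= 0 by rewrite mulr_ge0_le0 ?(ltW h0) //; lra.
    by lra.
  have : h * (g + eps / 2) <= h * (C + 1) by rewrite ler_pM2l //; lra.
  by lra.
have Kunif e : 0 < e -> exists2 delta, 0 < delta & forall u w, box u -> box w ->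
    (forall p, `|u p - w p| <= delta) -> forall p, `|K u p - K w p| <= e.
  move=> e0.
  have e2 : 0 < e / 2 / h by rewrite !divr_gt0.
  have /choice[dl hdl] : forall i : 'I_N, exists delta, 0 < delta /\
      forall (t : R) (x : 'rV[R]_N) (y : 'rV[R]_k) (x' : 'rV[R]_N) (y' : 'rV[R]_k), `|t - a| <= T ->
      in_box B x -> in_box B y ->
      (forall l, `|x 0 l - x' 0 l| <= delta) -> (forall j, `|y 0 j - y' 0 j| <= delta) ->
      `|Phi i t x y - Phi i t x' y'| < e / 2 / h.
    by move=> i; have [delta d1 d2] := Phi_unif_box B a i e2; exists delta.
  pose dm := \big[Num.min/(e / 2)]_i dl i.
  exists dm; first by apply/bigmin_gtP; split; [lra | move=> j _; case: (hdl j)].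
  move=> u w bu bw uw [i q]; rewrite /K /step /=; set z := _ - 1.
  have d1 : dm <= e / 2 by apply: bigmin_le_id.
  have d2 : dm <= dl i by apply: bigmin_le_cond.
  have : `|G u i z - G w i z| < e / 2 / h.
    have [_ hh] := hdl i; apply: hh.
    - rewrite addrAC subrr add0r normrM (gtr0_norm h0) -nh ler_pM2r //.
      rewrite -intr_norm [leRHS]pmulrn ler_int; apply: ord_pred_le.
    - exact: rowbox.
    - exact: rowbox2.
    - by move=> l; rewrite !mxE; apply: le_trans (uw _) d2.
    - by move=> l; rewrite !mxE; apply: le_trans (uw _) d2.
  rewrite ltr_pdivlMr // mulrC => gg.
  have vv : `|V u i z - V w i z| <= e / 2 by apply: le_trans (uw _) d1.
  have -> : V u i z + h * (G u i z + eps / 2) - (V w i z + h * (G w i z + eps / 2)) =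
     V u i z - V w i z + h * (G u i z - G w i z) by ring.
  apply: le_trans (ler_normD _ _) _; rewrite normrM (gtr0_norm h0); lra.
have I0 : (0 < #|I|)%N by rewrite card_prod !card_ord muln_gt0 N0.
(* The step adds [eps / 2]; with this tolerance the actual [theta] lies between [eps / 4] and
   [3 * eps / 4]. *)
have e0 : 0 < h * eps / 4 by rewrite divr_gt0 // mulr_gt0.
have [u [ubox uK]] := brouwer_box I0 B0 Kbox Kunif e0.
exists (V u); split => [i z|i z|i z]; [by rewrite -[n.+1%:Z]mul1r V_per|exact: ubox|].
have Kz : K u (i, idx (z + 1)) = step u i z.
  rewrite /K /= idx_val -(step_per u i ((z + 1) %/ n.+1%:Z)%Z); congr step.
  by rewrite addrAC [(_ %% _)%Z + _]addrC -divz_eq addrK.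
have := uK (i, idx (z + 1)); rewrite Kz -/(V u i (z + 1)) /step.
rewrite ler_norml => /andP[k1 k2].
exists ((V u i (z + 1) - V u i z) / h - G u i z); split; last first.
  by rewrite /G; field; rewrite gt_eqF.
have e1 : (V u i (z + 1) - V u i z) / h - G u i z =
  eps / 2 + (V u i (z + 1) - (V u i z + h * (G u i z + eps / 2))) / h.
  by field; rewrite gt_eqF.
rewrite e1.
have q1 : - (eps / 4) <= (V u i (z + 1) - (V u i z + h * (G u i z + eps / 2))) / h.
  by rewrite ler_pdivlMr //; lra.
have q2 : (V u i (z + 1) - (V u i z + h * (G u i z + eps / 2))) / h <= eps / 4.
  by rewrite ler_pdivrMr //; lra.
by apply/andP; split; lra.
Qed.

End EulerOrbit.

(** * Passage to the limit along an ultrafilter *)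

Lemma ultrafilter_fmap (T U : Type) (f : T -> U) (F : set_system T) :
  UltraFilter F -> UltraFilter (f @ F).
Proof.
move=> FU; split; first exact: fmap_proper_filter.
move=> G GF fG; apply/seteqP; split => // A GA.
have [//|FnA] := in_ultra_setVsetC (f @^-1` A) FU.
have : G (A `&` ~` A) by apply: filterI => //; apply: fG.
by rewrite setICr => /filter_not_empty.
Qed.

(** Stands in for the extraction of subsequences: one ultrafilter gives limits at all times and for
    all components simultaneously. *)
Lemma segment_ultra_cvg (R : realType) (T : Type) (U : set_system T) (g : T -> R) (a b : R) :
  UltraFilter U -> (forall q, a <= g q <= b) -> exists2 l, a <= l <= b & g @ U --> l.
Proof.
move=> UU gab; have := @segment_compact R a b; rewrite compact_ultra.
move=> /(_ (g @ U) (ultrafilter_fmap g UU)) [|l [/= lab gl]].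
  by apply: (@filterE T U _ (g @^-1` `[a, b])) => q /=; rewrite in_itv /= gab.
by exists l => //; move: lab; rewrite in_itv.
Qed.

(** Letting both endpoints vary makes the criterion insensitive to the side of [t]: Euler increments
    are always summed forwards. *)
Lemma is_derive_of_increments (R : realType) (f : R -> R) (t p : R) :
  (forall e, 0 < e -> exists2 rho, 0 < rho & forall s1 s2, s1 <= s2 ->
    `|s1 - t| <= rho -> `|s2 - t| <= rho ->
    `|f s2 - f s1 - (s2 - s1) * p| <= e * (s2 - s1)) ->
  is_derive t 1 f p.
Proof.
move=> hf.
suff cvp : (fun h : R => h^-1 *: (f (h *: 1 + t) - f t)) @ 0^' --> p.
  by apply: DeriveDef; [apply/cvg_ex; exists p|apply: cvg_lim cvp].
apply/cvgrPdist_le => e e0; have [rho rho0 hrho] := hf e e0.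
near=> h.
have h0 : h != 0 by near: h; exact: nbhs_dnbhs_neq.
have hr : `|h| <= rho by near: h; apply: dnbhs0_le.
rewrite /GRing.scale /= mulr1.
have -> : p - h^-1 * (f (h + t) - f t) = - (h^-1 * (f (h + t) - f t - h * p)).
  by field.
rewrite normrN normrM normfV mulrC ler_pdivrMr ?normr_gt0 //.
have [hp|hn] := leP 0 h.
  have := hrho t (h + t); rewrite subrr normr0 addrK (ger0_norm hp).
  by apply; [lra|exact: ltW|rewrite -(ger0_norm hp)].
have := hrho (h + t) t; rewrite subrr normr0 addrK (ltr0_norm hn).
have -> : f t - f (h + t) - (t - (h + t)) * p = - (f (h + t) - f t - h * p) by ring.
rewrite normrN; have -> : t - (h + t) = - h by ring.
by apply; [lra|rewrite -(ltr0_norm hn)|exact: ltW].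
Unshelve. all: by end_near. Qed.

Section Limit.
Variables (R : realType) (N k : nat) (T : R) (tau : 'I_k -> R).
Variables (Phi : 'I_N -> R -> 'rV[R]_N -> 'rV[R]_k -> R).
Hypothesis T_gt0 : 0 < T.
Hypothesis Phi_continuous : forall i,
  continuous (fun z : R * ('rV[R]_N * 'rV[R]_k) => Phi i z.1 z.2.1 z.2.2).

Variables (a B L : R) (n_ : nat -> nat) (eps_ : nat -> R).
Variable v_ : nat -> 'I_N -> int -> R.
Let h_ q : R := T / (n_ q)%:R.
Hypothesis n_gt0 : forall q, (0 < n_ q)%N.
Hypothesis h_to0 : forall e, 0 < e -> \forall q \near \oo, h_ q < e.
Hypothesis eps_to0 : forall e, 0 < e -> \forall q \near \oo, eps_ q < e.
Hypothesis eps_le1 : forall q, eps_ q <= 1.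
Hypothesis v_orbit : forall q, euler_orbit tau Phi a (h_ q) (eps_ q) B (n_ q) (v_ q).
Hypothesis L_ge0 : 0 <= L.
Hypothesis Phi_le : forall i t x y, in_box B x -> in_box B y -> `|Phi i t x y| + 1 <= L.

Let h_gt0 q : 0 < h_ q. Proof. by rewrite divr_gt0 ?ltr0n. Qed.

Let v_box q i z : 0 <= v_ q i z <= B. Proof. by case: (v_orbit q) => _ + _; apply. Qed.

Let v_per q i (m : int) z : v_ q i (z + (n_ q)%:Z * m) = v_ q i z.
Proof.
rewrite -mulrzz; apply: (periodic_int (f := v_ q i) (T := (n_ q)%:Z)) => z'.
by case: (v_orbit q) => + _ _; apply.
Qed.

Let v_step q i z : `|v_ q i (z + 1) - v_ q i z| <= h_ q * L.
Proof.
have [_ _ /(_ i z)[th [/andP[th0 th1] ->]]] := v_orbit q.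
rewrite addrAC subrr add0r normrM (gtr0_norm (h_gt0 q)) ler_pM2l //.
apply: le_trans (ler_normD _ _) _;
  apply: le_trans (Phi_le i (a + z%:~R * h_ q) (x := \row_l v_ q l z)
  (y := \row_j v_ q i (z - Num.floor (tau j / h_ q))) _ _).
- by rewrite lerD2l gtr0_norm //; apply: le_trans th1 (eps_le1 q).
- by move=> l; rewrite mxE; apply: v_box.
- by move=> l; rewrite mxE; apply: v_box.
Qed.

Let v_lip q i z1 z2 : `|v_ q i z1 - v_ q i z2| <= `|z1 - z2|%:~R * h_ q * L.
Proof.
wlog z12 : z1 z2 / z2 <= z1 => [hw|].
  have [/hw//|/ltW/hw] := leP z2 z1.
  by rewrite distrC (distrC z2).
have [m ->] : exists m : nat, z1 = z2 + m%:Z by exists `|z1 - z2|%N; lia.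
rewrite (addrC z2) addrK; elim: m => [|m IH]; first by rewrite add0r subrr normr0 !mul0r.
have -> : m.+1%:Z + z2 = m%:Z + z2 + 1 by lia.
have -> : v_ q i (m%:Z + z2 + 1) - v_ q i z2 =
  (v_ q i (m%:Z + z2 + 1) - v_ q i (m%:Z + z2)) + (v_ q i (m%:Z + z2) - v_ q i z2) by ring.
apply: le_trans (ler_normD _ _) _.
apply: le_trans (lerD (v_step _ _ _) IH) _.
by rewrite !ger0_norm // -!pmulrn -natr1; lra.
Qed.

(** The last grid index at or before time [s]; [X] below is the corresponding step function. *)
Let id_ q s : int := Num.floor ((s - a) / h_ q).

Let id_le q s : a + (id_ q s)%:~R * h_ q <= s.
Proof. by rewrite -lerBrDl -ler_pdivlMr // floor_le. Qed.

Let id_gt q s : s < a + (id_ q s)%:~R * h_ q + h_ q.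
Proof.
have := floorD1_gt ((s - a) / h_ q); rewrite ltr_pdivrMr // rmorphD /= -/(id_ q s).
by lra.
Qed.

Let X q i s := v_ q i (id_ q s).

Let X_lip q i s1 s2 : `|X q i s1 - X q i s2| <= L * (`|s1 - s2| + h_ q).
Proof.
apply: le_trans (v_lip _ _ _ _) _; rewrite mulrC ler_wpM2l // intr_norm.
have h0 := h_gt0 q.
rewrite -[X in _ * X <= _](gtr0_norm h0) -normrM rmorphB /= mulrBl.
have := id_le q s1; have := id_le q s2; have := id_gt q s1; have := id_gt q s2.
have := ler_norm (s1 - s2); have := ler_norm (s2 - s1); rewrite (distrC s2) => *.
by rewrite ler_norml; apply/andP; split; lra.
Qed.

Let X_grid q i t (z : int) D :
  `|t - (a + z%:~R * h_ q)| <= D -> `|X q i t - v_ q i z| <= L * (D + h_ q).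
Proof.
move=> tD; have -> : v_ q i z = X q i (a + z%:~R * h_ q).
  by rewrite /X /id_ addrAC subrr add0r mulfK ?gt_eqF // intrKfloor.
by apply: le_trans (X_lip _ _ _ _) _; rewrite ler_wpM2l // lerD2r.
Qed.

(** A telescoping sum of Euler steps. The grid points used miss the endpoints by less than one step,
    whence the last error term. *)
Let X_increment q i s1 s2 p e : 0 <= e -> s1 <= s2 ->
  (forall z : int, s1 - h_ q <= a + z%:~R * h_ q <= s2 ->
     `|v_ q i (z + 1) - v_ q i z - h_ q * p| <= h_ q * e) ->
  `|X q i s2 - X q i s1 - (s2 - s1) * p| <= e * (s2 - s1) + h_ q * (e + `|p|).
Proof.
move=> e0 s12 hz; have h0 := h_gt0 q.
have [m em] : exists m : nat, id_ q s2 = id_ q s1 + m%:Z.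
  have : id_ q s1 <= id_ q s2.
    by apply: le_floor; rewrite ler_pM2r ?invr_gt0 // lerD2r.
  by exists `|id_ q s2 - id_ q s1|%N; lia.
have tele (j : nat) : (j <= m)%N ->
    `|v_ q i (id_ q s1 + j%:Z) - v_ q i (id_ q s1) - j%:R * h_ q * p| <= j%:R * h_ q * e.
  elim: j => [|j IH] jm; first by rewrite addr0 subrr !mul0r subr0 normr0.
  have -> : id_ q s1 + j.+1%:Z = id_ q s1 + j%:Z + 1 by lia.
  have hj : `|v_ q i (id_ q s1 + j%:Z + 1) - v_ q i (id_ q s1 + j%:Z) - h_ q * p| <= h_ q * e.
    apply: hz; apply/andP; split.
      have : 0 <= j%:R * h_ q by rewrite mulr_ge0 // ltW.
      by rewrite rmorphD /= -pmulrn mulrDl; have := id_gt q s1; lra.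
    apply: le_trans (id_le q s2); rewrite em lerD2l ler_pM2r // ler_int; lia.
  have := ler_normD (v_ q i (id_ q s1 + j%:Z + 1) - v_ q i (id_ q s1 + j%:Z) - h_ q * p)
    (v_ q i (id_ q s1 + j%:Z) - v_ q i (id_ q s1) - j%:R * h_ q * p).
  have -> : v_ q i (id_ q s1 + j%:Z + 1) - v_ q i (id_ q s1 + j%:Z) - h_ q * p +
    (v_ q i (id_ q s1 + j%:Z) - v_ q i (id_ q s1) - j%:R * h_ q * p) =
    v_ q i (id_ q s1 + j%:Z + 1) - v_ q i (id_ q s1) - j.+1%:R * h_ q * p.
    by rewrite -natr1; ring.
  by have := IH (ltnW jm); rewrite -natr1; lra.
have := tele m (leqnn m); rewrite -em -/(X q i s2) -/(X q i s1) => hm.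
have a1 := id_le q s1; have a2 := id_le q s2; have a3 := id_gt q s1; have a4 := id_gt q s2.
move: a2 a4; rewrite em rmorphD /= mulrDl -pmulrn => a2 a4.
have d1 : `|m%:R * h_ q - (s2 - s1)| <= h_ q by rewrite ler_norml; apply/andP; split; lra.
have d2 : m%:R * h_ q * e <= e * (s2 - s1) + h_ q * e.
  have : m%:R * h_ q <= s2 - s1 + h_ q by lra.
  by move=> /(ler_wpM2r e0); lra.
have d3 : `|(m%:R * h_ q - (s2 - s1)) * p| <= h_ q * `|p| by rewrite normrM ler_wpM2r.
have -> : X q i s2 - X q i s1 - (s2 - s1) * p =
  X q i s2 - X q i s1 - m%:R * h_ q * p + (m%:R * h_ q - (s2 - s1)) * p by ring.
by apply: le_trans (ler_normD _ _) _; rewrite mulrDr; lra.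
Qed.

(** Pointwise convergence suffices: the Lipschitz bound uniform in [q] carries closeness at [t] and
    at the delayed times over to neighbouring times. *)
Lemma euler_limit r : (forall q, exists i z, r <= v_ q i z) -> 0 < r ->
  exists x : R -> 'rV[R]_N,
    [/\ forall i (t : R), is_derive t 1 (fun s : R => x s 0 i)
                      (Phi i t (x t) (\row_j x (t - tau j) 0 i)),
        forall t, x (t + T) = x t,
        forall t, in_box B (x t) &
        exists t, x t != 0].
Proof.
move=> v_large r0.
have [U [UU oU]] : exists U : set_system nat, UltraFilter U /\ \oo `<=` U.
  exact: ultraFilterLemma.
have /choice[xl xlP] : forall p : R * 'I_N,
    exists l : R, 0 <= l <= B /\ (fun q => X q p.2 p.1) @ U --> l.
  move=> p; have [l l1 l2] := segment_ultra_cvg UU (fun q => v_box q p.2 (id_ q p.1)).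
  by exists l.
pose x s : 'rV[R]_N := \row_i xl (s, i).
have xbox s : in_box B (x s) by move=> i; rewrite mxE; case: (xlP (s, i)).
have Xx s i e : 0 < e -> \forall q \near U, `|x s 0 i - X q i s| < e.
  by move=> e0; rewrite mxE; have [_ /cvgrPdist_lt] := xlP (s, i); apply.
have hU e : 0 < e -> \forall q \near U, h_ q < e by move=> e0; apply/oU/h_to0.
have epsU e : 0 < e -> \forall q \near U, eps_ q < e by move=> e0; apply/oU/eps_to0.
have fI (P Q : set nat) : U P -> U Q -> U (P `&` Q) by apply: filterI.
have L0 := L_ge0.
exists x; split => [i t|t||].
- apply: is_derive_of_increments => e e0; set y := \row_j _; set p := Phi i t (x t) y.
  have e2 : 0 < e / 2 by lra.
  have /cvgrPdist_lt/(_ _ e2)/nbhs_normP[dl /= dl0 hdl] := @Phi_continuous i (t, (x t, y)).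
  (* As soon as [3 * h_ q <= rho], values at times within [rho + 2 * h_ q] of the reference time
     differ by at most [L * (rho + 3 * h_ q) <= 2 * rho * L <= dl / 2]. *)
  pose rho := dl / 4 / (L + 1).
  have rho0 : 0 < rho by rewrite !divr_gt0 //; lra.
  have rhoL : rho * L + rho = dl / 4 by rewrite /rho; field; apply/eqP; lra.
  have rhoL0 : 0 <= rho * L by rewrite mulr_ge0 // ltW.
  exists rho => // s1 s2 s12 s1t s2t; apply/ler_addgt0Pr => e1 e10.
  have e4 : 0 < e1 / 4 by lra.
  have ep : 0 < e1 / 4 / (e + `|p| + 1).
    by rewrite divr_gt0 //; have := normr_ge0 p; lra.
  have dl4 : 0 < dl / 4 by lra.
  have U1 : \forall q \near U, forall l, `|x t 0 l - X q l t| < dl / 4.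
    by apply: filter_forall => l; apply: Xx.
  have U2 : \forall q \near U, forall j, `|x (t - tau j) 0 i - X q i (t - tau j)| < dl / 4.
    by apply: filter_forall => j; apply: Xx.
  have rho3 : 0 < rho / 3 by lra.
  (* Only finitely many closeness conditions are involved, so a single [q] meets them all; it may
     depend on [s1], [s2] and [e1]. *)
  have /(@filter_ex _ U _)[q [[q1 q2] [[q3 q4] [[q5 q6] q7]]]] := fI _ _
    (fI _ _ U1 U2) (fI _ _ (fI _ _ (Xx s1 i _ e4) (Xx s2 i _ e4))
    (fI _ _ (fI _ _ (hU _ ep) (epsU _ e2)) (hU _ rho3))).
  have h0 := h_gt0 q.
  have inc : `|X q i s2 - X q i s1 - (s2 - s1) * p| <= e * (s2 - s1) + h_ q * (e + `|p|).
    apply: X_increment => //; first exact: ltW.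
    move=> z /andP[z1 z2].
    have [_ _ /(_ i z)[th [/andP[th0 th1] ->]]] := v_orbit q.
    set w := Phi _ _ _ _.
    have -> : v_ q i z + h_ q * (w + th) - v_ q i z - h_ q * p = h_ q * (w + th - p) by ring.
    rewrite normrM (gtr0_norm h0) ler_pM2l //.
    suff pw : `|p - w| < e / 2.
      have -> : w + th - p = th - (p - w) by ring.
      apply: le_trans (ler_normB _ _) _; rewrite gtr0_norm //; lra.
    have zt : `|a + z%:~R * h_ q - t| <= rho + h_ q.
      rewrite ler_norml.
      by move: s1t s2t; rewrite !ler_norml => /andP[? ?] /andP[? ?]; apply/andP; split; lra.
    have hL : L * (rho + 3 * h_ q) <= dl / 2.
      have : 0 <= (rho / 3 - h_ q) * L by rewrite mulr_ge0 // subr_ge0 ltW.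
      by lra.
    have hL2 : L * (rho + 2 * h_ q) <= L * (rho + 3 * h_ q).
      by rewrite ler_wpM2l // lerD2l ler_pM2r // ler_nat.
    apply: (hdl (a + z%:~R * h_ q, (_, _))); rewrite /= !prod_normE /= !gt_max.
    apply/and3P; split.
    - rewrite distrC; apply: le_lt_trans zt _.
      by lra.
    - apply: row_norm_lt => // l; rewrite !mxE.
      have c1 := q1 l; rewrite mxE in c1; rewrite distrC in zt.
      have c2 := X_grid l zt.
      have := ler_distD (X q l t) (xl (t, l)) (v_ q l z).
      by lra.
    - apply: row_norm_lt => // j; rewrite !mxE.
      have c1 := q2 j; rewrite mxE in c1.
      set m := Num.floor _.
      have /andP[m1 m2] := floor_itv (tau j / h_ q).
      move: m1 m2; rewrite ler_pdivlMr // ltr_pdivrMr // -/m rmorphD /= => m1 m2.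
      have tz : `|(t - tau j) - (a + (z - m)%:~R * h_ q)| <= rho + 2 * h_ q.
        move: zt.
        by rewrite rmorphB /= !ler_norml => /andP[? ?]; apply/andP; split; lra.
      have c2 := X_grid i tz.
      have := ler_distD (X q i (t - tau j)) (xl (t - tau j, i)) (v_ q i (z - m)).
      by lra.
  have hh : h_ q * (e + `|p|) <= e1 / 4.
    move: q5; rewrite ltr_pdivlMr; last by have := normr_ge0 p; lra.
    by have := h0; lra.
  have -> : x s2 0 i - x s1 0 i - (s2 - s1) * p = (x s2 0 i - X q i s2) -
    (x s1 0 i - X q i s1) + (X q i s2 - X q i s1 - (s2 - s1) * p) by ring.
  apply: le_trans (ler_normD _ _) _.
  have := ler_normB (x s2 0 i - X q i s2) (x s1 0 i - X q i s1); lra.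
- apply/rowP => i; rewrite !mxE.
  have [_ c1] := xlP (t, i); have [_ c2] := xlP (t + T, i).
  apply: (@cvg_unique _ (@norm_hausdorff _ _) _ _ _ _ c2 _) => /=.
  suff -> : (fun q => X q i (t + T)) = (fun q => X q i t) by [].
  apply/funext => q; rewrite /X.
  have -> : id_ q (t + T) = id_ q t + (n_ q)%:Z.
    have n0 : (n_ q)%:R != 0 :> R by rewrite pnatr_eq0 -lt0n.
    rewrite /id_ -[RHS]/(_ + _) -(intrKfloor (R := R) (n_ q)%:Z) -floorDrz //.
    congr Num.floor; rewrite /h_ -pmulrn; field.
    by rewrite n0 gt_eqF.
  by rewrite -[(n_ q)%:Z]mulr1 v_per.
- exact: xbox.
(* The indices of large values are brought into one period, so that the corresponding times are
   bounded and converge to some [ts]. The component may vary with [q], hence closeness at [a + ts]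
   is required of all components. *)
pose zr q i z := r <= v_ q i z /\ 0 <= z < (n_ q)%:Z.
have /choice[iz hiz] : forall q, exists p : 'I_N * int, zr q p.1 p.2.
  move=> q; have [i [z hz]] := v_large q.
  have nz : (n_ q)%:Z != 0 by have := n_gt0 q; lia.
  exists (i, (z %% (n_ q)%:Z)%Z); split => /=.
    by rewrite -(v_per _ _ (z %/ (n_ q)%:Z)%Z) mulrC addrC -divz_eq.
  by rewrite modz_ge0 // ltz_pmod //; have := n_gt0 q; lia.
pose tq q : R := (iz q).2%:~R * h_ q.
have tqT q : 0 <= tq q <= T.
  have [_ /andP[z0 zn]] := hiz q; have h0 := h_gt0 q.
  rewrite mulr_ge0 ?ler0z ?(ltW h0) //=.
  have -> : T = (n_ q)%:R * h_ q by rewrite /h_ mulrC divfK // pnatr_eq0 -lt0n.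
  by rewrite ler_pM2r // [leRHS]pmulrn ler_int ltW.
have [ts _ tsP] := segment_ultra_cvg UU tqT.
exists (a + ts); apply/eqP => x0.
have r2 : 0 < r / 2 by lra.
have rL : 0 < r / 4 / (L + 1) by rewrite divr_gt0 //; lra.
have rL2 : r / 4 / (L + 1) * L <= r / 4 - r / 4 / (L + 1).
  by rewrite -subr_ge0 le_eqVlt; apply/orP; left; apply/eqP; field; apply/eqP; lra.
have U1 : \forall q \near U, forall l, `|x (a + ts) 0 l - X q l (a + ts)| < r / 2.
  by apply: filter_forall => l; apply: Xx.
move/cvgrPdist_lt/(_ _ rL) : tsP => tsP.
have /(@filter_ex _ U _)[q [[q1 q2] q3]] := fI _ _ (fI _ _ U1 tsP) (hU _ rL).
have [rv _] := hiz q; set i := (iz q).1 in rv; set z := (iz q).2 in rv.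
have h0 := h_gt0 q.
have := X_lip q i (a + tq q) (a + ts).
have -> : X q i (a + tq q) = v_ q i z.
  by rewrite /X /id_ addrAC subrr add0r mulfK ?gt_eqF // intrKfloor.
have -> : a + tq q - (a + ts) = - (ts - tq q) by ring.
rewrite normrN => c1.
have c2 : L * (`|ts - tq q| + h_ q) <= L * (2 * (r / 4 / (L + 1))).
  by rewrite ler_wpM2l //; lra.
have := q1 i; rewrite x0 mxE sub0r normrN => c3.
have := ler_normB (v_ q i z - X q i (a + ts)) (- X q i (a + ts)).
rewrite opprK subrK normrN => c4.
by have := ler_norm (v_ q i z); lra.
Qed.

End Limit.

(* The weight of the minimum argument, up to an affine change: slope [m - 1] during
   the first [p] of the [m * p] steps of a period, slope [-1] afterwards. *)
Definition sawtooth (m p : nat) (z : int) : nat :=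
  let q := `|(z %% (m * p)%:Z)%Z|%N in minn (q * m.-1) (m * p - q).

Lemma sawtooth_le m p z : (sawtooth m p z <= m * p)%N.
Proof. by rewrite /sawtooth; apply: leq_trans (geq_minr _ _) (leq_subr _ _). Qed.

Lemma sawtooth_nat m p q : (q < m * p)%N ->
  sawtooth m p q = minn (q * m.-1) (m * p - q).
Proof. by move=> qn; rewrite /sawtooth modz_small //; lia. Qed.

Lemma sawtooth_period m p : sawtooth m p (m * p)%:Z = 0%N.
Proof. by rewrite /sawtooth modzz /= mul0n min0n. Qed.

Lemma sawtooth_up m p q : (0 < m)%N -> (q < m * p)%N ->
  (sawtooth m p (q%:Z + 1)%R <= sawtooth m p q + m.-1)%N.
Proof.
move=> m0 qn; have -> : (q%:Z + 1 = q.+1%:Z)%R by lia.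
have [e|qn1] := eqVneq q.+1 (m * p)%N; first by rewrite e sawtooth_period.
rewrite !sawtooth_nat //; last by lia.
by rewrite mulSn; lia.
Qed.

Lemma sawtooth_down m p q : (0 < m)%N -> (p <= q < m * p)%N ->
  (sawtooth m p (q%:Z + 1)%R + 1 <= sawtooth m p q)%N.
Proof.
move=> m0 /andP[pq qn]; have -> : (q%:Z + 1 = q.+1%:Z)%R by lia.
have qm : (m * p - q <= q * m.-1)%N.
  have : (m * p <= q * m)%N by rewrite mulnC leq_mul2r pq orbT.
  by have := mulnS q m.-1; rewrite prednK //; lia.
have [e|qn1] := eqVneq q.+1 (m * p)%N.
  by rewrite e sawtooth_period sawtooth_nat //; lia.
by rewrite !sawtooth_nat //; lia.
Qed.

(** * Lower bound for Euler orbits, uniform in the step *)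

Section LowerBound.
Variables (R : realType) (N k : nat) (T : R) (tau : 'I_k -> R).
Variables (Phi : 'I_N -> R -> 'rV[R]_N -> 'rV[R]_k -> R).

(** If all values were below [r], let [v / w] be minimal at [z + 1]. By the last hypothesis one step
    from [z] multiplies the lower bound [c * w z] by [1 - h * eta], or by [1 + h * kappa] on the
    favourable interval; either way it reaches [c * w (z + 1)], and [theta > 0] makes the inequality
    strict. *)
Lemma euler_orbit_large (a eps B eta kappa rho r : R) (m p : nat) v :
    let h := T / (m * p)%:R in
    0 < T -> (0 < N)%N -> (0 < m)%N -> (0 < p)%N ->
    euler_orbit tau Phi a h eps B (m * p) v ->
    (forall i t x y, in_box B x -> in_box B y -> 0 <= x 0 i + h * Phi i t x y) ->
    0 < eta -> 2 * eta * T <= rho -> rho <= 1 -> 2 * eta * m%:R <= kappa ->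
    (forall i t (x : 'rV[R]_N) (y : 'rV[R]_k) c, (forall l, 0 < x 0 l < r) ->
      (forall j, 0 < y 0 j < r) ->
       0 < c -> (forall l, c <= x 0 l) -> (forall j, c <= (1 + rho) * y 0 j) ->
       c * (1 - h * eta) <= x 0 i + h * Phi i t x y /\
       (a <= t <= a + T / m%:R -> c * (1 + h * kappa) <= x 0 i + h * Phi i t x y)) ->
  exists i z, r <= v i z.
Proof.
move=> h T0 N0 m0 p0 [vper vbox vstep] pos eta0 etaT rho1 etam low.
have n0 : (0 < m * p)%N by rewrite muln_gt0 m0.
have nR : (m * p)%:R != 0 :> R by rewrite pnatr_eq0 -lt0n.
have h0 : 0 < h by rewrite divr_gt0 // ltr0n.
have nh : (m * p)%:R * h = T by rewrite /h mulrC divfK.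
apply: contrapT => small.
have vr i z : v i z < r.
  by rewrite ltNge; apply/negP => rv; apply: small; exists i, z.
have rowbox z : in_box B (\row_l v l z) by move=> l; rewrite mxE; apply: vbox.
have rowbox2 i g : in_box B (\row_(j < k) v i (g j)) by move=> l; rewrite mxE; apply: vbox.
have v0 i z : 0 < v i z.
  rewrite -(subrK 1 z); have [th [/andP[th0 _] ->]] := vstep i (z - 1).
  have := pos i (a + (z - 1)%:~R * h) _ _ (rowbox (z - 1))
    (rowbox2 i (fun j => z - 1 - Num.floor (tau j / h))).
  by rewrite mxE; have := mulr_gt0 h0 th0; lra.
have vper_int i (q : int) z : v i (z + (m * p)%:Z * q) = v i z.
  by rewrite -mulrzz; apply: (periodic_int (f := v i) (T := (m * p)%:Z)) => z'; apply: vper.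
(* The factor 2 compensates [w <= 2]: a decrease by [2 * eta * h] is at least [w z * eta * h]. An
   increase is at most [2 * eta * h * m <= h * kappa]. *)
pose w z : R := 1 + 2 * eta * h * (sawtooth m p z)%:R.
have eh : 0 < 2 * eta * h by rewrite mulr_gt0 // mulr_gt0.
have w1 z : 1 <= w z by rewrite /w lerDl mulr_ge0 // ltW.
have w2 z : w z <= 1 + rho.
  rewrite /w lerD2l; apply: le_trans etaT; rewrite -nh.
  have : (sawtooth m p z)%:R <= (m * p)%:R :> R by rewrite ler_nat sawtooth_le.
  by move=> /(ler_wpM2l (ltW eh)); lra.
have w_per q z : w (z + (m * p)%:Z * q) = w z.
  by rewrite /w /sawtooth [(_ * q)%R]mulrC [(z + _)%R]addrC modzMDl.
have w0 z : 0 < w z by apply: lt_le_trans (w1 z).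
(* The shift by one puts the minimum at the end of the Euler step that starts at the index [s.2]. *)
pose F (s : 'I_N * 'I_(m * p)) : R := v s.1 ((s.2 : nat)%:Z + 1) / w ((s.2 : nat)%:Z + 1).
have [[i q] minF] : exists s, forall s', F s <= F s'.
  pose s0 : 'I_N * 'I_(m * p) := (Ordinal N0, Ordinal n0).
  by case: (arg_minP F (i0 := s0) (P := xpredT) isT) => s _ hs; exists s => s'; apply: hs.
pose c := F (i, q).
have c0 : 0 < c by rewrite /c /F divr_gt0.
have cw l z : c * w z <= v l z.
  rewrite -ler_pdivlMr //.
  have [q' [e' z1]] := int_residue (z - 1) n0.
  have -> : z = (q' : nat)%:Z + 1 + (m * p)%:Z * e' by rewrite addrAC -z1 subrK.
  by rewrite vper_int w_per; apply: (minF (l, q')).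
have vq : v i ((q : nat)%:Z + 1) = c * w ((q : nat)%:Z + 1) by rewrite /c /F divfK ?gt_eqF.
set z : int := (q : nat)%:Z in vq.
have [th [/andP[th0 _] e]] := vstep i z.
(* Present values are at least [c * w z]. Delayed ones are only known to be at least [c], as their
   weight is another one, and [w z <= 1 + rho] accounts for the difference. *)
have [low1 low2] := low i (a + z%:~R * h) (\row_l v l z)
  (\row_j v i (z - Num.floor (tau j / h))) (c * w z)
  ltac:(by move=> l; rewrite mxE v0 vr) ltac:(by move=> l; rewrite mxE v0 vr)
  (mulr_gt0 c0 (w0 z)) ltac:(by move=> l; rewrite mxE cw)
  ltac:(move=> j; rewrite mxE; apply: le_trans (_ : c * (1 + rho) <= _);
    [by rewrite ler_pM2l // w2|rewrite mulrC ler_wpM2l //;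
     [by apply: le_trans (w2 z); apply: ltW|
      by apply: le_trans (cw i (z - Num.floor (tau j / h))); rewrite ler_peMr // ltW]]).
move: low1 low2; rewrite mxE => low1 low2.
have hth := mulr_gt0 h0 th0.
have qn := ltn_ord q.
have [qp|pq] := ltnP q p.
  have tJ : a <= a + z%:~R * h <= a + T / m%:R.
    rewrite lerDl lerD2l mulr_ge0 ?ler0z ?(ltW h0) //=.
    have -> : T / m%:R = p%:R * h.
      by rewrite -nh natrM; field; rewrite pnatr_eq0 -lt0n.
    by rewrite ler_pM2r // /z -pmulrn ler_nat ltnW.
  have := low2 tJ.
  have : c * w (z + 1) <= c * w z * (1 + h * kappa).
    rewrite -mulrA ler_pM2l //.
    have : (sawtooth m p (z + 1))%:R <= (sawtooth m p z)%:R + m%:R :> R.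
      rewrite -natrD ler_nat; apply: leq_trans (sawtooth_up m0 qn) _.
      by rewrite leq_add2l leq_pred.
    move=> /(ler_wpM2l (ltW eh)) u1.
    have u2 : 0 <= (w z - 1) * (h * kappa).
      rewrite mulr_ge0 ?subr_ge0 // mulr_ge0 ?(ltW h0) //.
      by apply: le_trans etam; rewrite !mulr_ge0 // ltW.
    have u3 : 2 * eta * m%:R * h <= kappa * h by rewrite ler_pM2r.
    have -> : w (z + 1) = 1 + 2 * eta * h * (sawtooth m p (z + 1))%:R by [].
    have : w z = 1 + 2 * eta * h * (sawtooth m p z)%:R by [].
    by lra.
  by move: vq; rewrite e; lra.
have : c * w (z + 1) <= c * w z * (1 - h * eta).
  rewrite -mulrA ler_pM2l //.
  have : (sawtooth m p (z + 1))%:R + 1 <= (sawtooth m p z)%:R :> R.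
    by rewrite natr1 -addn1 ler_nat; apply: sawtooth_down; rewrite ?pq.
  move=> /(ler_wpM2l (ltW eh)) u1.
  have u2 : 0 <= (2 - w z) * (h * eta).
    apply: mulr_ge0 (mulr_ge0 (ltW h0) (ltW eta0)).
    by have := w2 z; lra.
  have -> : w (z + 1) = 1 + 2 * eta * h * (sawtooth m p (z + 1))%:R by [].
  have : w z = 1 + 2 * eta * h * (sawtooth m p z)%:R by [].
  by lra.
by move: vq; rewrite e; lra.
Qed.

End LowerBound.

(** The numbers of steps are multiples of [m], so that the first [p] of the [m * p] steps start in
    the interval of length [T / m]; the offset [q0] makes even the largest step small enough for an
    invariant box. *)
Lemma periodic_solution_exists (R : realType) (N k : nat) (T : R) (tau : 'I_k -> R)
    (Phi : 'I_N -> R -> 'rV[R]_N -> 'rV[R]_k -> R)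
    (a M C B eta kappa rho r : R) (m : nat) :
    (0 < N)%N -> 0 < T -> (0 < m)%N -> 0 < B -> 0 <= M ->
    (forall i, continuous (fun z : R * ('rV[R]_N * 'rV[R]_k) => Phi i z.1 z.2.1 z.2.2)) ->
    (forall i t x y, Phi i (t + T) x y = Phi i t x y) ->
    (forall i t x y, in_box B x -> in_box B y -> - (M * x 0 i) <= Phi i t x y <= C) ->
    (forall i t x y, in_box B x -> in_box B y -> B - 1 <= x 0 i -> Phi i t x y <= - 1) ->
    0 < r -> 0 < eta -> 2 * eta * T <= rho -> rho <= 1 -> 2 * eta * m%:R <= kappa ->
    (forall h i t (x : 'rV[R]_N) (y : 'rV[R]_k) c, 0 < h -> h * M <= 1 ->
       (forall l, 0 < x 0 l < r) -> (forall j, 0 < y 0 j < r) ->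
       0 < c -> (forall l, c <= x 0 l) -> (forall j, c <= (1 + rho) * y 0 j) ->
       c * (1 - h * eta) <= x 0 i + h * Phi i t x y /\
       (a <= t <= a + T / m%:R -> c * (1 + h * kappa) <= x 0 i + h * Phi i t x y)) ->
  exists x : R -> 'rV[R]_N,
    [/\ forall i (t : R), is_derive t 1 (fun s : R => x s 0 i)
                      (Phi i t (x t) (\row_j x (t - tau j) 0 i)),
        forall t, x (t + T) = x t,
        forall t, in_box B (x t) &
        exists t, x t != 0].
Proof.
move=> N0 T0 m0 B0 M0 Phic Phip PhiMC PhiB r0 eta0 etaT rho1 etam low.
have inv_small e : 0 < e -> \forall q \near \oo, (q.+1%:R : R)^-1 < e.
  by move=> e0; apply: (near_infty_natSinv_lt (PosNum e0)).
pose S := M + `|C| + 1.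
have S0 : 0 < S by rewrite /S; have := normr_ge0 C; lra.
pose q0 := Num.truncn (T * S).
pose n_ q := (m * (q + q0).+1)%N.
have n0 q : (0 < n_ q)%N by rewrite muln_gt0 m0.
pose h_ q : R := T / (n_ q)%:R.
have h0 q : 0 < h_ q by rewrite divr_gt0 // ltr0n.
have hle q (d : nat) : (d <= q + q0)%N -> h_ q <= T / d.+1%:R.
  move=> dq; rewrite /h_ ler_pM2l // lef_pV2 ?posrE ?ltr0n // ler_nat /n_.
  by apply: leq_trans (leq_pmull _ m0); rewrite ltnS.
have hS q : h_ q * S <= 1.
  have : h_ q <= T / q0.+1%:R by apply: hle; rewrite leq_addl.
  have : T * S <= q0.+1%:R by apply/ltW/truncnS_gt.
  move=> u1 /(ler_wpM2r (ltW S0)) u2; apply: le_trans u2 _.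
  by rewrite mulrAC ler_pdivrMr // mul1r.
have hM q : h_ q * M <= 1.
  apply: le_trans (hS q); rewrite ler_pM2l // /S; have := normr_ge0 C; lra.
have hC q : h_ q * (C + 1) <= 1.
  apply: le_trans (hS q); rewrite ler_pM2l // /S; have := ler_norm C; lra.
have eps01 (q : nat) : 0 < (q.+1%:R : R)^-1 <= 1.
  by rewrite invr_gt0 ltr0n /= invf_le1 ?ltr0n // ler1n.
have /choice[v vP] : forall q, exists v,
    euler_orbit tau Phi a (h_ q) (q.+1%:R)^-1 B (n_ q) v.
  move=> q; have := @euler_orbit_exists R N k T tau Phi T0 Phic Phip a M C B
    (q.+1%:R)^-1 (n_ q).-1 N0.
  rewrite prednK // -/(h_ q); apply => //; exact: hC.
pose L := M * B + `|C| + 1.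
have MB : 0 <= M * B by rewrite mulr_ge0 // ltW.
apply: (@euler_limit R N k T tau Phi T0 Phic a B L n_ (fun q => (q.+1%:R)^-1) v _ _ _ _ _ _ _ r).
- exact: n0.
- move=> e e0; have eT : 0 < e / T by rewrite divr_gt0.
  near=> q; apply: le_lt_trans (hle q q (leq_addr _ _)) _.
  rewrite mulrC -ltr_pdivlMr //; near: q; exact: inv_small.
- by move=> e e0; near=> q; near: q; exact: inv_small.
- by move=> q; case/andP: (eps01 q).
- exact: vP.
- by rewrite /L; have := normr_ge0 C; lra.
- move=> i t x y bx by_; rewrite /L lerD2r ler_norml.
  have := PhiMC i t x y bx by_ => /andP[u1 u2].
  have : M * x 0 i <= M * B by rewrite ler_wpM2l //; case/andP: (bx i).
  have := normr_ge0 C; have := ler_norm C.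
  by move=> ? ? ?; apply/andP; split; lra.
- move=> q; apply: (euler_orbit_large (m := m)
  (p := (q + q0).+1) T0 N0 m0 _ (vP q) _ eta0 etaT rho1 etam) => //.
    move=> i t x y bx by_; have /andP[u1 _] := PhiMC i t x y bx by_.
    have /andP[x0 _] := bx i.
    have : 0 <= x 0 i * (1 - h_ q * M) by rewrite mulr_ge0 // subr_ge0.
    have : h_ q * - (M * x 0 i) <= h_ q * Phi i t x y by rewrite ler_pM2l.
    by rewrite -/(h_ q); lra.
  by move=> i t x y c *; apply: low => //; [exact: (h0 q)|exact: (hM q)].
- exact: r0.
Unshelve. all: by end_near. Qed.

(** * Estimates for the system *)

Section LimfBounds.
Variables (T : choiceType) (X : filteredType T) (R : realType).
Implicit Types (f : X -> \bar R) (F : set_system X) (A : set X) (c : \bar R).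
Local Open Scope ereal_scope.

Lemma limf_esup_le f F A c : F A -> (forall x, A x -> f x <= c) -> limf_esup f F <= c.
Proof.
move=> FA fc; rewrite limf_esupE; apply: ereal_inf_le.
exists (ereal_sup (f @` A)); first by exists A.
by apply: ub_ereal_sup => _ [x Ax <-]; apply: fc.
Qed.

Lemma limf_esup_ge f F c : (forall A, F A -> exists2 x, A x & c <= f x) -> c <= limf_esup f F.
Proof.
move=> h; rewrite limf_esupE; apply: le_ereal_inf_tmp => _ [A /h[x Ax cx] <-].
by apply: le_trans cx _; apply: ereal_sup_ubound; exists x.
Qed.

Lemma limf_einf_ge f F A c : F A -> (forall x, A x -> c <= f x) -> c <= limf_einf f F.
Proof.
move=> FA fc; rewrite /limf_einf leeNr; apply: (limf_esup_le FA) => x Ax.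
by rewrite leeN2 fc.
Qed.

Lemma limf_einf_le f F c : (forall A, F A -> exists2 x, A x & f x <= c) -> limf_einf f F <= c.
Proof.
move=> h; rewrite /limf_einf leeNl; apply: limf_esup_ge => A /h[x Ax xc].
by exists x; rewrite ?leeN2.
Qed.

End LimfBounds.

Lemma coord_filter_ex (R : realType) N (i : 'I_N) (F : set_system R) (A : set 'rV[R]_N) :
  ProperFilter F -> (\forall y \near F, 0 < y) -> coord_filter i F A ->
  exists2 x, A x & orthant x /\ 0 < x 0 i.
Proof.
move=> FF F0 FA; have /filter_ex[y [y0 hy]] : F ([set y | 0 < y] `&`
    [set y | forall x : 'rV[R]_N, orthant x -> x 0 i = y -> A x]) by exact: filterI.
exists (const_mx y); last by split => [j|]; rewrite mxE // ltW.
by apply: hy; rewrite ?mxE // => j; rewrite mxE ltW.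
Qed.

Lemma within_continuous_comp (X Y Z : topologicalType) (A : set Y) (f : Y -> Z) (g : X -> Y) :
  {within A, continuous f} -> continuous g -> (forall x, A (g x)) -> continuous (f \o g).
Proof.
move=> /subspace_continuousP cf cg gA x.
apply: cvg_trans (cf (g x) (gA x)) => P /= h.
have := cg x _ h; rewrite /= !nbhs_simpl /=; apply: filterS => z; apply; exact: gA.
Qed.

(** If no [F n] contained an interval, the complements would be dense open sets with empty
    intersection. *)
Lemma baire_interval (R : realType) (F : nat -> set R) :
  (forall n, closed (F n)) -> (forall t, exists n, F n t) ->
  exists n, exists a b : R, a < b /\ forall t, a <= t <= b -> F n t.
Proof.
move=> Fcl Fcov; apply: contrapT => noint.
have dF n : open (~` F n) /\ dense (~` F n).
  split; first by rewrite openC.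
  move=> O [t Ot] oO; apply: contrapT => h.
  have OF : O `<=` F n.
    by move=> s Os; apply: contrapT => nF; apply: h; exists s.
  have /nbhs_ballP[e /= e0 he] : nbhs t O by apply: open_nbhs_nbhs; split.
  apply: noint; exists n, (t - e / 2), (t + e / 2); split; first lra.
  move=> s st; apply/OF/he; rewrite /ball /= ltr_norml; lra.
have [||t [_ ht]] := Baire dF (O := setT); [by exists 0|exact: openT|].
by have [n hn] := Fcov t; apply: (ht n).
Qed.

Lemma max0_lip (R : realType) (x y : R) : `|Num.max 0 x - Num.max 0 y| <= `|x - y|.
Proof.
have := ler_norm (x - y); have := ler_norm (y - x); rewrite (distrC y x).
by case: (leP 0 x); case: (leP 0 y) => ? ? ? ?; rewrite ?subrr ?normr0 // ler_norml; apply/andP;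
  split; lra.
Qed.

Lemma max0_continuous (R : realType) : continuous (Num.max 0 : R -> R).
Proof.
move=> x; apply/cvgrPdist_lt => e e0; near=> y.
apply: le_lt_trans (max0_lip _ _) _.
by near: y; apply: cvgr_dist_lt.
Unshelve. all: by end_near. Qed.

(** A continuous retraction onto the orthant. Composing with it extends coefficients that are
    constrained only there to continuous functions on the whole space. *)
Definition posv (R : realType) N (x : 'rV[R]_N) : 'rV[R]_N := \row_l Num.max 0 (x 0 l).

Lemma posv_continuous (R : realType) N : continuous (@posv R N).
Proof.
move=> x; apply/(cvgrPdist_lt (FF := nbhs_filter x)) => e e0.
apply/(@nbhs_normP R 'rV[R]_N); exists e => //= y xy.
apply: row_norm_lt => // l; rewrite !mxE; apply: le_lt_trans (max0_lip _ _) _.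
by apply: le_lt_trans xy; have := coord_le_norm (x - y) l; rewrite !mxE.
Qed.

Lemma posv_orthant (R : realType) N (x : 'rV[R]_N) : orthant (posv x).
Proof. by move=> l; rewrite mxE le_max lexx. Qed.

Lemma posv_id (R : realType) N (x : 'rV[R]_N) : orthant x -> posv x = x.
Proof. by move=> x0; apply/rowP => l; rewrite mxE; apply/max_idPr. Qed.

Lemma ricker_continuous (R : realType) : continuous (@ricker R).
Proof.
move=> x; apply: cvgM; first exact: cvg_id.
by apply: continuous_comp; [exact: opp_continuous|exact: continuous_expR].
Qed.

Lemma ricker_ge0 (R : realType) (y : R) : 0 <= y -> 0 <= ricker y.
Proof. by move=> y0; rewrite mulr_ge0 ?expR_ge0. Qed.

Lemma ricker_le1 (R : realType) (y : R) : 0 <= y -> ricker y <= 1.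
Proof.
move=> y0; rewrite /ricker expRN ler_pdivrMr ?expR_gt0 // mul1r.
by have := expR_ge1Dx y; lra.
Qed.

Lemma ricker_ge (R : realType) (y : R) : 0 <= y -> y * (1 - y) <= ricker y.
Proof. by move=> y0; rewrite ler_wpM2l //; have := expR_ge1Dx (- y); lra. Qed.

Lemma sum_continuous (R : realType) (X : topologicalType) (I : Type) (s : seq I) (P : pred I)
    (f : I -> X -> R) : (forall i, P i -> continuous (f i)) ->
  continuous (fun x => \sum_(i <- s | P i) f i x).
Proof.
move=> cf x; elim: s => [|i s IH].
  rewrite (_ : (fun x => _) = fun=> 0); first exact: cvg_cst.
  by apply/funext => y; rewrite big_nil.
rewrite (_ : (fun x => _) =
    fun x => (if P i then f i x else 0) + \sum_(j <- s | P j) f j x); last first.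
  by apply/funext => y; rewrite big_cons; case: ifP; rewrite // add0r.
by apply: cvgD => //; case: ifP => [/cf|_]; [apply|apply: cvg_cst].
Qed.

Lemma pair_continuous (X Y Z : topologicalType) (f : X -> Y) (g : X -> Z) :
  continuous f -> continuous g -> continuous (fun x => (f x, g x)).
Proof. by move=> cf cg x; apply: cvg_pair; [apply: cf|apply: cg]. Qed.

(** * The right-hand side of the system and its coefficients at zero and infinity *)

Section System.
Variables (R : realType) (N k : nat) (T : R).
Variables (d : 'I_N -> R -> R -> R) (b : 'I_N -> 'I_N -> R -> R -> R).
Variables (p : 'I_N -> 'I_k -> R -> R) (H : 'I_N -> R -> 'rV[R]_N -> R).
Hypothesis d_cont : forall i, {within [set z : R * R | 0 <= z.2],
  continuous (fun z : R * R => d i z.1 z.2)}.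
Hypothesis b_cont : forall i l : 'I_N, l != i -> {within [set z : R * R | 0 <= z.2],
  continuous (fun z : R * R => b i l z.1 z.2)}.
Hypothesis p_cont : forall i j, continuous (p i j).
Hypothesis H_cont : forall i, {within [set z : R * 'rV[R]_N | orthant z.2],
  continuous (fun z : R * 'rV[R]_N => H i z.1 z.2)}.
Hypothesis d_ge0 : forall i t y, 0 <= y -> 0 <= d i t y.
Hypothesis b_ge0 : forall (i l : 'I_N) t y, l != i -> 0 <= y -> 0 <= b i l t y.
Hypothesis p_ge0 : forall i j t, 0 <= p i j t.
Hypothesis H_ge0 : forall i t (x : 'rV[R]_N), orthant x -> 0 <= H i t x.
Hypothesis d_per : forall i t y, 0 <= y -> d i (t + T) y = d i t y.
Hypothesis b_per : forall (i l : 'I_N) t y, l != i -> 0 <= y -> b i l (t + T) y = b i l t y.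
Hypothesis p_per : forall i j t, p i j (t + T) = p i j t.
Hypothesis H_per : forall i t (x : 'rV[R]_N), orthant x -> H i (t + T) x = H i t x.

Local Notation G := (Gsum d H).

Definition Phi (i : 'I_N) (t : R) (x : 'rV[R]_N) (y : 'rV[R]_k) : R :=
  - d i t (posv x 0 i) + \sum_(l < N | l != i) b i l t (posv x 0 l)
  + \sum_(j < k) p i j t * ricker (y 0 j) - H i t (posv x).

Let max0_coord_continuous (X : topologicalType) (g : X -> 'rV[R]_N) l :
  continuous g -> continuous (fun z => posv (g z) 0 l).
Proof.
move=> cg z; apply: (@continuous_comp _ _ _ g (fun x => posv x 0 l)); first exact: cg.
apply: (@continuous_comp _ _ _ (@posv R N) (fun x : 'rV[R]_N => x 0 l)).
  exact: posv_continuous.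
exact: coord_continuous.
Qed.

Let d_comp_continuous (X : topologicalType) (g : X -> R) (f : X -> 'rV[R]_N) i :
  continuous g -> continuous f -> continuous (fun z => d i (g z) (posv (f z) 0 i)).
Proof.
move=> cg cf; apply: (within_continuous_comp (@d_cont i) (g := fun z => (g z, posv (f z) 0 i))).
  by apply: pair_continuous => //; apply: max0_coord_continuous.
by move=> z /=; apply: posv_orthant.
Qed.

Let H_comp_continuous (X : topologicalType) (g : X -> R) (f : X -> 'rV[R]_N) i :
  continuous g -> continuous f -> continuous (fun z => H i (g z) (posv (f z))).
Proof.
move=> cg cf; apply: (within_continuous_comp (@H_cont i) (g := fun z => (g z, posv (f z)))).
  apply: pair_continuous => // z.
  by apply: (@continuous_comp _ _ _ f (@posv R N)); [exact: cf|exact: posv_continuous].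
by move=> z /=; apply: posv_orthant.
Qed.

Lemma Phi_continuous i :
  continuous (fun z : R * ('rV[R]_N * 'rV[R]_k) => Phi i z.1 z.2.1 z.2.2).
Proof.
have c1 : continuous (fun z : R * ('rV[R]_N * 'rV[R]_k) => z.1) by move=> z; apply: cvg_fst.
have c2 : continuous (fun z : R * ('rV[R]_N * 'rV[R]_k) => z.2) by move=> z; apply: cvg_snd.
have c21 : continuous (fun z : R * ('rV[R]_N * 'rV[R]_k) => z.2.1).
  by move=> z; apply: (@continuous_comp _ _ _ snd fst); [exact: c2|exact: cvg_fst].
have c22 : continuous (fun z : R * ('rV[R]_N * 'rV[R]_k) => z.2.2).
  by move=> z; apply: (@continuous_comp _ _ _ snd snd); [exact: c2|exact: cvg_snd].
move=> z; rewrite /Phi; apply: cvgB; last exact: H_comp_continuous.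
apply: cvgD; first (apply: cvgD; first by apply: cvgN; apply: d_comp_continuous).
  apply: sum_continuous => l li.
  apply: (within_continuous_comp (@b_cont i l li)
    (g := fun z : R * ('rV[R]_N * 'rV[R]_k) => (z.1, posv z.2.1 0 l))).
    by apply: pair_continuous => //; apply: max0_coord_continuous.
  by move=> z' /=; apply: posv_orthant.
apply: sum_continuous => j _ z'; apply: cvgM.
  by apply: (@continuous_comp _ _ _ fst (p i j)); [exact: c1|exact: p_cont].
apply: (@continuous_comp _ _ _ (fun z : R * ('rV[R]_N * 'rV[R]_k) => z.2.2 0 j) (@ricker R)).
  apply: (@continuous_comp _ _ _ (fun z : R * ('rV[R]_N * 'rV[R]_k) => z.2.2)
    (fun x : 'rV[R]_k => x 0 j)); first exact: c22.
  exact: coord_continuous.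
exact: ricker_continuous.
Qed.

Lemma Phi_periodic i t x y : Phi i (t + T) x y = Phi i t x y.
Proof.
rewrite /Phi d_per ?posv_orthant // H_per; last exact: posv_orthant.
congr (_ + _ + _ - _); apply: eq_bigr => l li; last by rewrite p_per.
by rewrite b_per // posv_orthant.
Qed.

Lemma PhiE i t x y : orthant x -> Phi i t x y =
  - G i t x + \sum_(l < N | l != i) b i l t (x 0 l) + \sum_(j < k) p i j t * ricker (y 0 j).
Proof. by move=> x0; rewrite /Phi posv_id // /Gsum; ring. Qed.

Lemma G_ge0 i t x : orthant x -> 0 <= G i t x.
Proof. by move=> x0; rewrite addr_ge0 ?d_ge0 ?H_ge0. Qed.

Hypothesis G_bounded : forall i, exists M : R, forall t (x : 'rV[R]_N),
  orthant x -> 0 < x 0 i -> G i t x / x 0 i <= M.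

(** Boundedness of the quotient says nothing where [x 0 i = 0]. There continuity forces [G] to
    vanish, as seen by pushing [x] slightly inwards along the coordinate [i]. Nonnegativity of
    solutions rests on this bound. *)
Lemma G_linear_bound : exists2 M : R, 0 <= M & forall i t (x : 'rV[R]_N),
  orthant x -> G i t x <= M * x 0 i.
Proof.
have [m mP] := choice G_bounded.
pose M := \big[Num.max/0]_i m i.
have M0 : 0 <= M by apply: bigmax_ge_id.
have mM i : m i <= M by apply: le_bigmax_cond.
have GM i t (x : 'rV[R]_N) : orthant x -> 0 < x 0 i -> G i t x <= M * x 0 i.
  by move=> x0 xi; rewrite -ler_pdivrMr //; apply: le_trans (mP i t x x0 xi) (mM i).
exists M => // i t x x0; have : 0 <= x 0 i by apply: x0.
rewrite le_eqVlt => /orP[/eqP xi|xi]; last exact: GM.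
rewrite -xi mulr0; apply/ler_addgt0Pl => e e0; rewrite addr0.
have cG : continuous (fun s : R => G i t (posv (x + s *: delta_mx 0 i))).
  have cx : continuous (fun s : R => x + s *: (delta_mx 0 i : 'rV[R]_N)).
    move=> s; apply: cvgD; first exact: cvg_cst.
    by apply: cvgZr_tmp; apply: cvg_id.
  move=> s; apply: cvgD.
    by apply: (@d_comp_continuous _ (fun=> t) _ i _ cx) => ?; apply: cvg_cst.
  by apply: (@H_comp_continuous _ (fun=> t) _ i _ cx) => ?; apply: cvg_cst.
have /cvgrPdist_lt/(_ (e / 2) ltac:(lra))/nbhs_normP[r /= r0 hr] := cG 0.
pose s := Num.min (r / 2) (e / 2 / (M + 1)).
have s0 : 0 < s by rewrite lt_min !divr_gt0 //; lra.
have s1 : s <= r / 2 by rewrite /s ge_min lexx.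
have s2 : s <= e / 2 / (M + 1) by rewrite /s ge_min lexx orbT.
have sM : s * M <= e / 2.
  move: s2; rewrite ler_pdivlMr; last lra.
  by lra.
have := hr s; rewrite /= sub0r normrN (gtr0_norm s0) => /(_ ltac:(lra)).
rewrite scale0r addr0 posv_id //.
set x' := x + _ => h1.
have x'0 : orthant x'.
  by move=> l; rewrite !mxE addr_ge0 ?x0 // mulr_ge0 // ltW.
move: h1; rewrite posv_id // => h1.
have x'i : x' 0 i = s by rewrite !mxE -xi !eqxx mulr1 add0r.
have := GM i t x' x'0; rewrite x'i => /(_ s0) h2.
by move: h1; rewrite ltr_norml => /andP[? ?]; lra.
Qed.

Hypothesis unif : uniform_limits G b.

Let gz i t := fine (G_zero G i t).
Let gi i t := fine (G_infty G i t).
Let bz i l t := fine (b_zero b i l t).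
Let bi i l t := fine (b_infty b i l t).

Let at_right_gt0 : \forall y \near (0 : R)^'+, 0 < y. Proof. exact: nbhs_right_gt. Qed.

Let pinfty_gt0 : \forall y \near +oo, (0 : R) < y. Proof. exact: nbhs_pinfty_gt. Qed.

Section WithLinearBound.
Variable M : R.
Hypothesis GM : forall i t (x : 'rV[R]_N), orthant x -> G i t x <= M * x 0 i.

Lemma G_zeroE i t : G_zero G i t = (gz i t)%:E /\ 0 <= gz i t <= M.
Proof.
have h1 : (0%:E <= G_zero G i t)%E.
  apply: limf_esup_ge => A hA.
  have [x Ax [x0 xi]] := coord_filter_ex _ at_right_gt0 hA.
  by exists x => //; rewrite lee_fin divr_ge0 ?G_ge0 // ltW.
have h2 : (G_zero G i t <= M%:E)%E.
  apply: (limf_esup_le (A := [set x : 'rV[R]_N | orthant x /\ 0 < x 0 i])).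
    by apply: filterS at_right_gt0 => y y0 x x0 xy; split => //; rewrite xy.
  by move=> x [x0 xi]; rewrite lee_fin ler_pdivrMr //; apply: GM.
move: h1 h2; rewrite /gz; case: (G_zero G i t) => [g| |] //=.
by rewrite !lee_fin => -> ->.
Qed.

Lemma G_infty_le i t : (G_infty G i t <= M%:E)%E.
Proof.
apply: limf_einf_le => A hA.
have [x Ax [x0 xi]] := coord_filter_ex _ pinfty_gt0 hA.
by exists x => //; rewrite lee_fin ler_pdivrMr //; apply: GM.
Qed.

End WithLinearBound.

Lemma b_zero_ge i l t (c e : R) : 0 < e ->
  (forall y, 0 < y < e -> c * y <= b i l t y) -> (c%:E <= b_zero b i l t)%E.
Proof.
move=> e0 h; apply: (limf_einf_ge (A := [set y : R | 0 < y < e])).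
  have : \forall y \near (0 : R)^'+, 0 < y /\ y < e.
    by apply: filterI => //; apply: nbhs_right_lt.
  by apply: filterS => y [y0 ye]; apply/andP.
by move=> y /andP[y0 ye]; rewrite lee_fin ler_pdivlMr // h ?y0.
Qed.

(** Finiteness comes from the uniformity assumption: with error 1 it bounds [b_zero] by one actual
    quotient plus 1. *)
Lemma b_zeroE i l t : l != i -> b_zero b i l t = (bz i l t)%:E /\ 0 <= bz i l t.
Proof.
move=> li; have h1 : (0%:E <= b_zero b i l t)%E.
  apply: (@b_zero_ge _ _ _ _ 1) => // y /andP[y0 _].
  by rewrite mul0r b_ge0 // ltW.
have [s [S [s0 _ h]]] := unif ltr01.
have s2 : 0 < s / 2 < s by apply/andP; split; lra.
have [|_ _ hl] := h t (const_mx (s / 2)) i.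
  by move=> j; rewrite mxE; case/andP: s2 => /ltW.
have [+ _] := hl l li; rewrite !mxE => /(_ s2).
by move: h1; rewrite /bz; case: (b_zero b i l t) => [g| |].
Qed.

Lemma b_infty_ge0 i l t : l != i -> (0 <= b_infty b i l t)%E.
Proof.
move=> li; apply: limf_esup_ge => A hA.
have /filter_ex[y [y0 Ay]] : \forall y \near +oo, (0 : R) < y /\ A y by exact: filterI.
by exists y => //; rewrite lee_fin divr_ge0 ?b_ge0 // ltW.
Qed.

(** The limits at infinity stay in the extended reals here, since their finiteness is a consequence
    of the condition at infinity. *)
Lemma uniform_bounds M eta : (forall i t (x : 'rV[R]_N), orthant x -> G i t x <= M * x 0 i) ->
    0 < eta -> exists s S : R, [/\ 0 < s, 0 < S &
  forall t (x : 'rV[R]_N) i, orthant x ->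
    [/\ 0 < x 0 i < s -> G i t x <= (gz i t + eta) * x 0 i,
        S < x 0 i -> (G_infty G i t - eta%:E <= (G i t x / x 0 i)%:E)%E &
        forall l, l != i ->
          (0 < x 0 l < s -> (bz i l t - eta) * x 0 l <= b i l t (x 0 l)) /\
          (S < x 0 l -> ((b i l t (x 0 l) / x 0 l)%:E <= b_infty b i l t + eta%:E)%E)]].
Proof.
move=> GM eta0; have [s [S [s0 S0 h]]] := unif eta0.
exists s, S; split => // t x i x0; have [h1 h2 h3] := h t x i x0; split => //.
  move=> /andP[xi xs]; have := h1 ltac:(by rewrite xi).
  by have [-> _] := G_zeroE GM i t; rewrite -EFinD lee_fin ler_pdivrMr.
move=> l li; have [h4 h5] := h3 l li; split => // /andP[xi xs].
have := h4 ltac:(by rewrite xi).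
by have [-> _] := b_zeroE t li; rewrite -EFinB lee_fin ler_pdivlMr.
Qed.

Lemma zero_condition M delta i t :
    (forall i t (x : 'rV[R]_N), orthant x -> G i t x <= M * x 0 i) ->
    (G_zero G i t < (1 - delta)%:E * (\sum_(l < N | l != i) b_zero b i l t
                            + \sum_(j < k) (p i j t)%:E))%E ->
  gz i t < (1 - delta) * (\sum_(l < N | l != i) bz i l t + \sum_(j < k) p i j t).
Proof.
move=> GM; have [-> _] := G_zeroE GM i t.
rewrite (eq_bigr (fun l => (bz i l t)%:E)); last by move=> l /(b_zeroE t)[].
by rewrite !sumEFin -EFinD -EFinM lte_fin.
Qed.

Lemma infty_condition M beta i t :
    (forall i t (x : 'rV[R]_N), orthant x -> G i t x <= M * x 0 i) ->
    (\sum_(l < N | l != i) b_infty b i l t + beta%:E < G_infty G i t)%E ->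
  [/\ G_infty G i t = (gi i t)%:E, gi i t <= M,
      forall l, l != i -> b_infty b i l t = (bi i l t)%:E /\ 0 <= bi i l t &
      \sum_(l < N | l != i) bi i l t + beta < gi i t].
Proof.
move=> GM hlt; have gM := G_infty_le GM i t.
have sum0 : (0 <= \sum_(l < N | l != i) b_infty b i l t)%E.
  by apply: sume_ge0 => l li; apply: b_infty_ge0.
have sum_lt : (\sum_(l < N | l != i) b_infty b i l t < +oo)%E.
  move: (lt_le_trans hlt gM); case: (\sum_(l < N | l != i) b_infty b i l t)%E => [r| |] //=.
  by rewrite ltry.
have bfin l : l != i -> b_infty b i l t = (bi i l t)%:E /\ 0 <= bi i l t.
  move=> li; have := b_infty_ge0 t li; rewrite /bi.
  have : (b_infty b i l t < +oo)%E.
    apply: le_lt_trans sum_lt; rewrite (bigD1 l) //= leeDl // sume_ge0 // => j /andP[ji _].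
    exact: b_infty_ge0.
  by case: (b_infty b i l t) => [r| |] //=.
move: hlt; rewrite (eq_bigr (fun l => (bi i l t)%:E)); last by move=> l /bfin[].
rewrite sumEFin -EFinD; move: gM; rewrite /gi; case: (G_infty G i t) => [g| |] //=.
Qed.

Let inv_nat_le (e : R) : 0 < e -> exists n0, forall n, (n0 <= n)%N -> (n.+1%:R : R)^-1 <= e.
Proof.
move=> e0; exists (Num.truncn e^-1) => n hn.
rewrite invf_ple ?posrE ?ltr0n //; apply: le_trans (ltW (truncnS_gt _)) _.
by rewrite ler_nat ltnS.
Qed.

(* The lower coefficients [b_zero] are only semicontinuous in [t], so that a
   uniform positive lower bound is available on some interval, by Baire's
   theorem, but in general not for all [t]. *)
Lemma good_interval M :
    (forall i t (x : 'rV[R]_N), orthant x -> G i t x <= M * x 0 i) -> 0 < T ->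
    (forall i t, 0 < \sum_(l < N | l != i) bz i l t + \sum_(j < k) p i j t) ->
  exists a (m : nat) kappa, [/\ (0 < m)%N, 0 < kappa &
    forall t i, a <= t <= a + T / m%:R ->
      kappa <= \sum_(l < N | l != i) bz i l t + \sum_(j < k) p i j t].
Proof.
move=> GM T0 Spos.
pose e (n : nat) : R := n.+1%:R^-1.
have e0 n : 0 < e n by rewrite invr_gt0 ltr0n.
(* Positivity of [bz] is not a closed condition in [t]. A linear lower bound for [b] on a fixed
   interval of [y] is one, by continuity of [b] in [t] for each [y]. *)
pose good n i t := e n <= \sum_(j < k) p i j t \/
  exists l, l != i /\ forall y, 0 < y < e n -> e n * y <= b i l t y.
pose F n := [set t | forall i, good n i t].
have Fclosed n : closed (F n).
  rewrite -openC openE => t /existsNP[i /not_orP[/negP]]; rewrite -ltNge => pe bad.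
  have ball l : l != i -> exists y, 0 < y < e n /\ b i l t y < e n * y.
    move=> li; apply: contrapT => h; apply: bad; exists l; split => // y y0.
    by rewrite leNgt; apply/negP => by_; apply: h; exists y.
  have near_p : \forall t' \near t, \sum_(j < k) p i j t' < e n.
    have cp : continuous (fun t' => \sum_(j < k) p i j t').
      by apply: sum_continuous => j _; apply: p_cont.
    by apply: cvgr_lt (cp t) _ pe.
  have near_b : \forall t' \near t, forall l, l != i ->
      exists y, 0 < y < e n /\ b i l t' y < e n * y.
    apply: (@filter_forall _ _ (fun l t' => l != i -> exists y, 0 < y < e n /\ b i l t' y < e n * y)
      _ (nbhs_filter t)) => l.
    have [->|li] := eqVneq l i; first exact: nearW.
    have [y [y0 hy]] := ball l li.
    have cb : continuous (fun t' => b i l t' y).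
      apply: (within_continuous_comp (@b_cont i l li) (g := fun t' => (t', y))).
        by apply: pair_continuous => ?; [apply: cvg_id|apply: cvg_cst].
      by move=> t' /=; case/andP: y0 => /ltW.
    have : \forall t' \near t, b i l t' y < e n * y by apply: cvgr_lt (cb t) _ hy.
    by apply: filterS => t' h _; exists y.
  apply: filterS2 near_p near_b => t' h1 h2 /(_ i)[|[l [li h3]]]; first by rewrite leNgt h1.
  by have [y [y0]] := h2 l li; rewrite ltNge h3.
have Fcover t : exists n, F n t.
  have /choice[n0 hn0] : forall i, exists n0, forall n, (n0 <= n)%N -> good n i t.
    move=> i; have [P0|P0] := ltP 0 (\sum_(j < k) p i j t).
      by have [n0 hn0] := inv_nat_le P0; exists n0 => n /hn0 h; left.
    have [l li bl] : exists2 l, l != i & 0 < bz i l t.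
      apply: contrapT => h.
      have : \sum_(l < N | l != i) bz i l t <= 0.
        apply: sumr_le0 => l li; rewrite leNgt; apply/negP => bl; apply: h.
        by exists l.
      by have := Spos i t; lra.
    have b2 : 0 < bz i l t / 2 by lra.
    have [s [S [s0 _ h]]] := uniform_bounds GM b2.
    have [|n0 hn0] := @inv_nat_le (Num.min s (bz i l t / 2)); first by rewrite lt_min s0.
    exists n0 => n /hn0; rewrite le_min => /andP[es eb]; right; exists l;
      split => // y /andP[y0 ye].
    have [|_ _ hl] := h t (const_mx y) i; first by move=> j; rewrite mxE ltW.
    have [+ _] := hl l li; rewrite !mxE y0 (lt_le_trans ye es) => /(_ isT); apply: le_trans.
    by rewrite ler_pM2r //; rewrite -/(e n) in eb; lra.
  exists (\max_i n0 i) => i; apply: (hn0 i).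
  by apply: leq_bigmax.
have [n [a [a' [aa' hF]]]] := baire_interval Fclosed Fcover.
have [m hm] : exists m : nat, T / m.+1%:R <= a' - a.
  have [|m hm] := @inv_nat_le ((a' - a) / T); first by rewrite divr_gt0 // subr_gt0.
  exists m; have := hm m (leqnn m); rewrite ler_pdivlMr // mulrC; exact.
exists a, m.+1, (e n); split => // t i /andP[ta tm].
have p0 : 0 <= \sum_(j < k) p i j t by apply: sumr_ge0.
have b0 : 0 <= \sum_(l < N | l != i) bz i l t by apply: sumr_ge0 => l /(b_zeroE t)[].
have [|h|[l [li h]]] := hF t _ i; [by rewrite ta; apply: le_trans tm _; rewrite -lerBrDl|by lra|].
have := b_zero_ge (e0 n) h; have [-> _] := b_zeroE t li; rewrite lee_fin => bl.
rewrite (bigD1 l) //=.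
have : 0 <= \sum_(l' < N | (l' != i) && (l' != l)) bz i l' t.
  by apply: sumr_ge0 => l' /andP[/(b_zeroE t)[]].
by lra.
Qed.

(** Near the upper face, [G] is at least about [gi * (B - 1)], while each [b] is at most about
    [bi * B], or a constant when its argument is below [S]. The gap [beta] then wins for large
    [B]. *)
Lemma upper_estimate M beta : (0 < N)%N -> 0 < T -> 0 < beta -> 0 <= M ->
    (forall i t (x : 'rV[R]_N), orthant x -> G i t x <= M * x 0 i) ->
    (forall i t, (\sum_(l < N | l != i) b_infty b i l t + beta%:E < G_infty G i t)%E) ->
  exists2 B, 0 < B & forall i t x y, in_box B x -> in_box B y -> B - 1 <= x 0 i ->
    Phi i t x y <= - 1.
Proof.
move=> N0 T0 beta0 M0 GM hinf.
have NR : 0 < N%:R :> R by rewrite ltr0n.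
pose eta := beta / 2 / N%:R.
have eta0 : 0 < eta by rewrite !divr_gt0.
have Neta : N%:R * eta = beta / 2 by rewrite /eta; field; rewrite gt_eqF.
have [s [S [s0 S0 hS]]] := uniform_bounds GM eta0.
have bb i l : exists K, 0 <= K /\ (l != i -> forall t y, 0 <= y <= S -> b i l t y <= K).
  have [_|li] := eqVneq l i; first by exists 0.
  have cb : continuous (fun z : R * R => b i l z.1 (Num.max 0 z.2)).
    apply: (within_continuous_comp (@b_cont i l li) (g := fun z : R * R => (z.1, Num.max 0 z.2))).
      apply: pair_continuous => z; first exact: cvg_fst.
      apply: (@continuous_comp _ _ _ (fun z : R * R => z.2) (fun y : R => Num.max 0 y));
        first exact: cvg_snd.
      exact: max0_continuous.
    by move=> z /=; rewrite le_max lexx.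
  have [|K hK] := periodic_bounded T0 (@segment_compact R 0 S) cb.
    by move=> t y /=; rewrite b_per // le_max lexx.
  exists `|K|; split => // _ t y /andP[y0 yS].
  have := hK t y; rewrite /= in_itv /= y0 yS => /(_ isT).
  rewrite (max_idPr y0) => h; apply: le_trans (ler_norm _) _.
  by apply: le_trans h _; apply: ler_norm.
have /choice[Kb hKb] : forall q : 'I_N * 'I_N, exists K, 0 <= K /\
    (q.2 != q.1 -> forall t y, 0 <= y <= S -> b q.1 q.2 t y <= K) by move=> q; apply: bb.
have pb i : exists K, 0 <= K /\ forall t, \sum_(j < k) p i j t <= K.
  have cp : continuous (fun z : R * R => \sum_(j < k) p i j z.1).
    apply: sum_continuous => j _ z.
    by apply: (@continuous_comp _ _ _ fst (p i j)); [exact: cvg_fst|exact: p_cont].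
  have [|K hK] := periodic_bounded T0 (@segment_compact R 0 1) cp.
    by move=> t y /=; apply: eq_bigr => j _; rewrite p_per.
  exists `|K|; split => // t; have := hK t 0; rewrite /= in_itv /= lexx ler01 => /(_ isT) h.
  by apply: le_trans (ler_norm _) _; apply: le_trans h _; apply: ler_norm.
have /choice[Kp hKp] := pb.
pose K1 := \big[Num.max/0]_q Kb q; pose K2 := \big[Num.max/0]_i Kp i.
have K10 : 0 <= K1 by apply: bigmax_ge_id.
have K20 : 0 <= K2 by apply: bigmax_ge_id.
(* The errors [eta] use up half of [beta], and the other half times [B] must exceed the bounded
   terms plus 1. The term [M] pays for having [B - 1] instead of [B]. *)
pose C := 2 * (M + N%:R * K1 + K2 + 1) / beta.
have C0 : 0 < C.
  by rewrite divr_gt0 // mulr_gt0 //; have := mulr_ge0 (ltW NR) K10; lra.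
pose B := S + 2 + C.
have BC : beta / 2 * B >= M + N%:R * K1 + K2 + 1.
  have : beta / 2 * C = M + N%:R * K1 + K2 + 1 by rewrite /C; field; rewrite gt_eqF.
  have : 0 <= beta / 2 * (S + 2) by rewrite mulr_ge0 //; lra.
  by rewrite /B; lra.
have B0 : 0 < B by rewrite /B; lra.
exists B => // i t x y bx by_ xB.
have x0 : orthant x by move=> l; case/andP: (bx l).
rewrite PhiE //.
have [_ hG hb] := hS t x i x0.
have [giE giM biE hi] := infty_condition GM (hinf i t).
have xS : S < x 0 i by apply: lt_le_trans xB; rewrite /B; lra.
have xi0 : 0 < x 0 i by apply: lt_trans xS.
have Gge : (gi i t - eta) * x 0 i <= G i t x.
  by have := hG xS; rewrite giE -EFinB lee_fin ler_pdivlMr.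
have bsum : \sum_(l < N | l != i) b i l t (x 0 l) <= \sum_(l < N | l != i) ((bi i l t + eta) * B
  + K1).
  apply: ler_sum => l li; have [bE b0] := biE l li.
  have /andP[xl0 xlB] := bx l.
  have etab : 0 <= bi i l t + eta by lra.
  have [xlS|Sxl] := leP (x 0 l) S.
    have [_ /(_ li t (x 0 l))] := hKb (i, l); rewrite /= xl0 xlS => /(_ isT) h.
    have : Kb (i, l) <= K1 by apply: le_bigmax_cond.
    have : 0 <= (bi i l t + eta) * B by rewrite mulr_ge0 // ltW.
    by lra.
  have [_ /(_ Sxl)] := hb l li; rewrite bE -EFinD lee_fin ler_pdivrMr; last exact: lt_trans Sxl.
  have : (bi i l t + eta) * x 0 l <= (bi i l t + eta) * B by rewrite ler_wpM2l.
  by lra.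
have psum : \sum_(j < k) p i j t * ricker (y 0 j) <= K2.
  apply: (@le_trans _ _ (\sum_(j < k) p i j t)).
    apply: ler_sum => j _; rewrite ler_piMr // ricker_le1 //.
    by case/andP: (by_ j).
  have [_ /(_ t) h] := hKp i; apply: le_trans h _; exact: le_bigmax_cond.
have cardE (c : R) : \sum_(l < N | l != i) c = (N%:R - 1) * c.
  by rewrite sumr_const cardC1 card_ord -[in RHS](prednK N0) -natr1 addrK mulr_natl.
have sumE : \sum_(l < N | l != i) ((bi i l t + eta) * B + K1) =
    (\sum_(l < N | l != i) bi i l t) * B + (N%:R - 1) * (eta * B + K1).
  by rewrite mulr_suml -cardE -big_split /=; apply: eq_bigr => l _; ring.
rewrite sumE in bsum; move: hi giM bsum.
set sb := \sum_(l < N | l != i) bi i l t => hi giM bsum.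
have sb0 : 0 <= sb by apply: sumr_ge0 => l /biE[].
have etaN : eta <= beta / 2.
  by rewrite -Neta ler_peMl ?(ltW eta0) // ler1n.
have g1 : (sb + beta - eta) * (B - 1) <= (gi i t - eta) * x 0 i.
  apply: le_trans (_ : (gi i t - eta) * (B - 1) <= _); last first.
    by rewrite ler_wpM2l //; lra.
  by rewrite ler_wpM2r; [by []| |lra]; rewrite /B; lra.
have NB : (N%:R - 1) * (eta * B + K1) = N%:R * eta * B + N%:R * K1 - eta * B - K1 by ring.
by move: bsum g1; rewrite NB Neta; lra.
Qed.

(** For small arguments the right-hand side is bounded below by linear terms. Of the margin [delta]
    in the condition at zero, one half is spent on the delayed terms and one half is kept as growth;
    the [N] replacements of limits by quotients cost [eta] each. *)
Lemma lower_estimate M delta eta s c h i t (x : 'rV[R]_N) (y : 'rV[R]_k) :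
    (0 < N)%N -> 0 < delta < 1 -> 0 < eta <= 1 -> 0 < s <= delta / 8 -> 0 < c -> 0 < h ->
    h * (M + 1) <= 1 ->
    (forall i t (x : 'rV[R]_N), orthant x -> G i t x <= M * x 0 i) ->
    (forall t (x : 'rV[R]_N) i, orthant x ->
      (0 < x 0 i < s -> G i t x <= (gz i t + eta) * x 0 i) /\
      forall l, l != i -> 0 < x 0 l < s -> (bz i l t - eta) * x 0 l <= b i l t (x 0 l)) ->
    gz i t < (1 - delta) * (\sum_(l < N | l != i) bz i l t + \sum_(j < k) p i j t) ->
    (forall l, 0 < x 0 l < s) -> (forall j, 0 < y 0 j < s) ->
    (forall l, c <= x 0 l) -> (forall j, c <= (1 + delta / 4) * y 0 j) ->
  c * (1 + h * (delta / 2 * (\sum_(l < N | l != i) bz i l t + \sum_(j < k) p i j t)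
    - N%:R * eta)) <= x 0 i + h * Phi i t x y.
Proof.
move=> N0 /andP[d0 d1] /andP[eta0 eta1] /andP[s0 sd] c0 h0 hM GM hS hz xs ys cx cy.
have x0 : orthant x by move=> l; case/andP: (xs l) => /ltW.
have [/(_ (xs i)) hG hb] := hS t x i x0.
have [_ /andP[gz0 gzM]] := G_zeroE GM i t.
rewrite PhiE //.
have bsum : \sum_(l < N | l != i) (bz i l t - eta) * c <= \sum_(l < N | l != i) b i l t (x 0 l).
  apply: ler_sum => l li; have [neg|pos] := leP (bz i l t - eta) 0.
    apply: (@le_trans _ _ 0); last by apply: b_ge0.
    by rewrite mulr_le0_ge0 // ltW.
  by apply: le_trans (hb l li (xs l)); rewrite ler_pM2l.
have psum : \sum_(j < k) p i j t * ((1 - delta / 2) * c) <= \sum_(j < k) p i j t * ricker (y 0 j).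
  apply: ler_sum => j _; rewrite ler_wpM2l //.
  have /andP[y0 y1] := ys j; apply: le_trans (ricker_ge (ltW y0)).
  apply: (@le_trans _ _ ((1 - delta / 2) * ((1 + delta / 4) * y 0 j))).
    by rewrite ler_wpM2l //; lra.
  (* The product of [1 - delta / 2] and [1 + delta / 4] is [1 - delta / 4 - delta ^+ 2 / 8], which
     is below [1 - y 0 j] since [y 0 j < delta / 8]. *)
  have : 0 <= (delta / 4 + delta ^+ 2 / 8 - y 0 j) * y 0 j.
    by rewrite mulr_ge0 ?ltW //; have := exprn_gt0 2 d0; lra.
  by lra.
move: bsum psum; rewrite -!mulr_suml sumrB sumr_const cardC1 card_ord.
set sb := \sum_(l < N | l != i) bz i l t; set sp := \sum_(j < k) p i j t.
rewrite -/sb -/sp in hz => bsum psum.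
have sp0 : 0 <= sp by apply: sumr_ge0.
have sb0 : 0 <= sb by apply: sumr_ge0 => l /(b_zeroE t)[].
have cardE : eta *+ N.-1 = N%:R * eta - eta.
  by rewrite -[in RHS](prednK N0) -natr1 mulrDl mul1r addrK mulr_natl.
rewrite cardE in bsum.
(* This sign makes the explicit step nondecreasing in [x 0 i], so that [x 0 i] may be replaced by
   its lower bound [c]. *)
have hg : 0 <= 1 - h * (gz i t + eta).
  have : h * (gz i t + eta) <= h * (M + 1) by rewrite ler_pM2l //; lra.
  by lra.
have e1 : c * (1 - h * (gz i t + eta)) <= x 0 i * (1 - h * (gz i t + eta)) by rewrite ler_wpM2r.
have e2 : h * ((sb - (N%:R * eta - eta)) * c + sp * ((1 - delta / 2) * c) - (gz i t + eta) * x 0 i)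
   <= h * (- G i t x + \sum_(l < N | l != i) b i l t (x 0 l)
        + \sum_(j < k) p i j t * ricker (y 0 j)).
  by rewrite ler_pM2l //; lra.
have e3 : 0 <= h * c * ((1 - delta) * (sb + sp) - gz i t).
  by rewrite mulr_ge0 ?subr_ge0 ?(ltW hz) // mulr_ge0 // ltW.
have e4 : 0 <= h * c * (delta / 2 * sb) by rewrite !mulr_ge0 ?(ltW h0) ?(ltW c0) //; lra.
lra.
Qed.

Lemma nontrivial_periodic_solution (tau : 'I_k -> R) : (0 < N)%N -> 0 < T ->
    (exists2 delta : R, 0 < delta & forall (i : 'I_N) (t : R),
       (G_zero G i t < (1 - delta)%:E * (\sum_(l < N | l != i) b_zero b i l t
                            + \sum_(j < k) (p i j t)%:E))%E) ->
    (exists2 beta : R, 0 < beta & forall (i : 'I_N) (t : R),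
       (\sum_(l < N | l != i) b_infty b i l t + beta%:E < G_infty G i t)%E) ->
  exists x : R -> 'rV[R]_N, [/\ is_solution tau d b p H x, forall t, x (t + T) = x t,
    forall t, orthant (x t) & exists t, x t != 0].
Proof.
move=> N0 T0 [delta d0 hz0] [beta beta0 hinf].
have [M M0 GM] := G_linear_bound.
have hz i t := zero_condition GM (hz0 i t).
have S0 i t : 0 <= \sum_(l < N | l != i) bz i l t + \sum_(j < k) p i j t.
  by rewrite addr_ge0 ?sumr_ge0 // => l /(b_zeroE t)[].
have gz0 i t : 0 <= gz i t by have [_ /andP[]] := G_zeroE GM i t.
(* Otherwise the right-hand side of the condition at zero would be nonpositive, against
   [gz >= 0]. *)
have d1 : delta < 1.
  have := le_lt_trans (gz0 (Ordinal N0) 0) (hz (Ordinal N0) 0).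
  rewrite ltNge => /negP h; rewrite ltNge; apply/negP => d1; apply: h.
  by rewrite mulr_le0_ge0 // subr_le0.
have Spos i t : 0 < \sum_(l < N | l != i) bz i l t + \sum_(j < k) p i j t.
  by have := le_lt_trans (gz0 i t) (hz i t); rewrite pmulr_rgt0 // subr_gt0.
have [a [m [kappa [m0 kappa0 hJ]]]] := good_interval GM T0 Spos.
have NR : 0 < N%:R :> R by rewrite ltr0n.
have mR : 0 < m%:R :> R by rewrite ltr0n.
have m1 : 0 < 2 * m%:R + 1 :> R by lra.
(* The second bound keeps the weight below [1 + delta / 4]. The third gives
   [2 * e * m <= delta / 2 * kappa - e]: the net gain on the favourable interval covers the rise of
   the weight there. *)
pose e := Num.min 1 (Num.min (delta / 4 / (2 * T)) (delta / 2 * kappa / (2 * m%:R + 1))).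
have T2 : 0 < 2 * T by lra.
have dk : 0 < delta / 2 * kappa by rewrite mulr_gt0 //; lra.
have e0 : 0 < e by rewrite !lt_min ltr01 !divr_gt0.
have e1 : e <= 1 by rewrite /e ge_min lexx.
have eT : 2 * e * T <= delta / 4.
  have : e <= delta / 4 / (2 * T) by rewrite /e !ge_min lexx !orbT.
  by rewrite ler_pdivlMr //; lra.
have ek : e * (2 * m%:R + 1) <= delta / 2 * kappa.
  by rewrite -ler_pdivlMr // /e !ge_min lexx !orbT.
pose eta := e / N%:R.
have eta0 : 0 < eta by rewrite divr_gt0.
have Neta : N%:R * eta = e by rewrite /eta; field; rewrite gt_eqF.
have eta1 : eta <= 1.
  by apply: le_trans e1; rewrite -Neta ler_peMl ?(ltW eta0) // ler1n.
have [s1 [S [s10 _ hS]]] := uniform_bounds GM eta0.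
pose s := Num.min s1 (delta / 8).
have s0 : 0 < s by rewrite lt_min s10; lra.
have ss1 : s <= s1 by rewrite /s ge_min lexx.
have sd : s <= delta / 8 by rewrite /s ge_min lexx orbT.
have hS' t (x : 'rV[R]_N) i : orthant x ->
    (0 < x 0 i < s -> G i t x <= (gz i t + eta) * x 0 i) /\
    forall l, l != i -> 0 < x 0 l < s -> (bz i l t - eta) * x 0 l <= b i l t (x 0 l).
  move=> x0; have [h1 _ h2] := hS t x i x0; split.
    by move=> /andP[xi xs]; apply: h1; rewrite xi (lt_le_trans xs).
  move=> l li /andP[xl xs]; have [+ _] := h2 l li; apply.
  by rewrite xl (lt_le_trans xs).
have [B B0 hB] := upper_estimate N0 T0 beta0 M0 GM hinf.
have Cex i : exists C, forall t x y, in_box B x -> in_box B y -> Phi i t x y <= C.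
  have [|C hC] := periodic_bounded T0 (compact_setX (@compact_box R N B) (@compact_box R k B))
    (Phi_continuous (i := i)).
    by move=> t x /=; rewrite Phi_periodic.
  exists C => t x y bx by_; apply: le_trans (ler_norm _) _.
  by apply: (hC t (x, y)).
have [C hC] := choice Cex.
pose Cmax := \big[Num.max/0]_i C i.
have PhiMC i t x y : in_box B x -> in_box B y -> - ((M + 1) * x 0 i) <= Phi i t x y <= Cmax.
  move=> bx by_; have x0 : orthant x by move=> l; case/andP: (bx l).
  apply/andP; split; last by apply: le_trans (hC i t x y bx by_) _; apply: le_bigmax_cond.
  rewrite PhiE //.
  have : 0 <= \sum_(l < N | l != i) b i l t (x 0 l) by apply: sumr_ge0 => l li; apply: b_ge0.
  have : 0 <= \sum_(j < k) p i j t * ricker (y 0 j).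
    by apply: sumr_ge0 => j _; rewrite mulr_ge0 // ricker_ge0 //; case/andP: (by_ j).
  by have := GM i t x x0; have := x0 i; lra.
have low h i t (x : 'rV[R]_N) (y : 'rV[R]_k) c : 0 < h -> h * (M + 1) <= 1 ->
    (forall l, 0 < x 0 l < s) -> (forall j, 0 < y 0 j < s) ->
    0 < c -> (forall l, c <= x 0 l) -> (forall j, c <= (1 + delta / 4) * y 0 j) ->
    c * (1 - h * e) <= x 0 i + h * Phi i t x y /\
    (a <= t <= a + T / m%:R ->
      c * (1 + h * (delta / 2 * kappa - e)) <= x 0 i + h * Phi i t x y).
  move=> h0 hM xs ys c0 cx cy.
  have := @lower_estimate M delta eta s c h i t x y N0.
  rewrite d0 d1 eta0 eta1 s0 sd => /(_ isT isT isT c0 h0 hM GM hS' (hz i t) xs ys cx cy).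
  rewrite Neta => main; split; last move=> tJ; apply: le_trans main; rewrite ler_pM2l // lerD2l.
    rewrite -mulrN ler_pM2l //.
    have : 0 <= delta / 2 * (\sum_(l < N | l != i) bz i l t + \sum_(j < k) p i j t).
      by rewrite mulr_ge0 ?S0 //; lra.
    by lra.
  by rewrite ler_pM2l // lerD2r ler_pM2l ?hJ //; lra.
have M10 : 0 <= M + 1 by lra.
have d41 : delta / 4 <= 1 by lra.
have em : 2 * e * m%:R <= delta / 2 * kappa - e by lra.
have [x [x1 x2 x3 x4]] := periodic_solution_exists tau N0 T0 m0 B0 M10 Phi_continuous
  Phi_periodic PhiMC hB s0 e0 eT d41 em low.
exists x; have xo t : orthant (x t) by move=> l; case/andP: (x3 t l).
split => // i t; have := x1 i t; rewrite /Phi posv_id //.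
rewrite [X in _ + X - H _ _ _](eq_bigr (fun j => p i j t * ricker (x (t - tau j) 0 i))) //.
by move=> j _; rewrite mxE.
Qed.

End System.

Unset Implicit Arguments.

Theorem theorem3 (R : realType) (N k : nat) (hN : (1 <= N)%N) (hk : (1 <= k)%N)
    (T : R) (hT : 0 < T)
    (tau : 'I_k -> R) (htau : forall j, 0 < tau j)
    (d : 'I_N -> R -> R -> R) (b : 'I_N -> 'I_N -> R -> R -> R)
    (p : 'I_N -> 'I_k -> R -> R) (H : 'I_N -> R -> 'rV[R]_N -> R)
    (d_cont : forall i, {within [set z : R * R | 0 <= z.2],
                continuous (fun z : R * R => d i z.1 z.2)})
    (b_cont : forall i l : 'I_N, l != i -> {within [set z : R * R | 0 <= z.2],
                continuous (fun z : R * R => b i l z.1 z.2)})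
    (p_cont : forall i j, continuous (p i j))
    (H_cont : forall i, {within [set z : R * 'rV[R]_N | orthant z.2],
                continuous (fun z : R * 'rV[R]_N => H i z.1 z.2)})
    (d_ge0 : forall i t y, 0 <= y -> 0 <= d i t y)
    (b_ge0 : forall (i l : 'I_N) t y, l != i -> 0 <= y -> 0 <= b i l t y)
    (p_ge0 : forall i j t, 0 <= p i j t)
    (H_ge0 : forall i t (x : 'rV[R]_N), orthant x -> 0 <= H i t x)
    (d_per : forall i t y, 0 <= y -> d i (t + T) y = d i t y)
    (b_per : forall (i l : 'I_N) t y, l != i -> 0 <= y -> b i l (t + T) y = b i l t y)
    (p_per : forall i j t, p i j (t + T) = p i j t)
    (H_per : forall i t (x : 'rV[R]_N), orthant x -> H i (t + T) x = H i t x)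
    (G_bounded : forall i, exists M : R, forall t (x : 'rV[R]_N),
       orthant x -> 0 < x 0 i -> Gsum d H i t x / x 0 i <= M)
    (unif : uniform_limits (Gsum d H) b)
    (h_zero : exists2 delta : R, 0 < delta & forall (i : 'I_N) (t : R),
       (G_zero (Gsum d H) i t
        < (1 - delta)%:E * (\sum_(l < N | l != i) b_zero b i l t
                            + \sum_(j < k) (p i j t)%:E))%E)
    (h_infty : exists2 beta : R, 0 < beta & forall (i : 'I_N) (t : R),
       (\sum_(l < N | l != i) b_infty b i l t + beta%:E
        < G_infty (Gsum d H) i t)%E) :
  exists x : R -> 'rV[R]_N,
    [/\ is_solution tau d b p H x,
        forall t, x (t + T) = x t,
        forall t, orthant (x t)
      & exists t, x t != 0].
Proof.
exact: (@nontrivial_periodic_solution R N k T d b p H).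
Qed.
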